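(* Let $d\in\{3,7\}$, $K=\mathbb{Q}(\sqrt{-d})$, $L=\mathbb{Q}(\cos\tfrac{\pi}{21})$, so that $M=KL=\mathbb{Q}(\zeta_{42})$. (i) $\mathrm{Gal}(M/\mathbb{Q})\cong\mathbb{Z}/2\times\mathbb{Z}/2\times\mathbb{Z}/3$. (ii) There are $64$ CM types of $M$, forming $32$ conjugate pairs $\{\Phi,\overline{\Phi}\}$; all satisfy $\Phi\neq\overline{\Phi}$. (iii) Exactly $\binom{6}{3}=20$ oriented CM types are Weil-compatible (signature $(3,3)$ for $K$), forming $10$ conjugate pairs. (iv) These $20$ oriented CM types are in natural bijection with the $20$ components of the Weil locus $\mathcal{W}_K$, both being indexed by sign-assignments $\{1,\dots,6\}=I^+\sqcup I^-$ with $|I^+|=|I^-|=3$.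
   Context: $L=\mathbb{Q}(\cos\tfrac{\pi}{21})=\mathbb{Q}(\zeta_{42})^+$ is totally real of degree $6$ with ring of integers $\mathcal{O}_L$ and real embeddings $\sigma_1=\mathrm{id},\dots,\sigma_6$. Each $\sigma_i$ extends to a conjugate pair $\phi_i^\pm:M\to\mathbb{C}$ with $\phi_i^\pm(\sqrt{-d})=\pm i\sqrt d$. A CM type of $M$ (an ''oriented'' CM type) is a subset $\Phi\subset\mathrm{Hom}(M,\mathbb{C})$ of cardinality $6$ with $\Phi\sqcup\overline{\Phi}=\mathrm{Hom}(M,\mathbb{C})$, where $\overline\Phi$ is the complex-conjugate set. It is Weil-compatible if it contains exactly three embeddings of the form $\phi_i^+$. A sign-assignment $(I^+,I^-)$ corresponds to the CM type $\Phi_{I^+,I^-}=\{\phi_i^+:i\in I^+\}\cup\{\phi_i^-:i\in I^-\}$. $X_L=\mathbb{H}^6/\mathrm{SL}_2(\mathcal{O}_L)$ (action via $(\sigma_1,\dots,\sigma_6)$) coarsely parametrizes principally polarized complex abelian sixfolds with real multiplication by $\mathcal{O}_L$; $H^{1,0}(A)=\bigoplus_i H^{1,0}_{\sigma_i}(A)$ is the decomposition into one-dimensional $L$-eigenspaces. Such an $A$ is of Weil type for $K$ if there is an embedding $\eta:K\hookrightarrow\mathrm{End}^0(A)=\mathrm{End}(A)\otimes\mathbb{Q}$ such that (1) $\eta$ commutes with the $\mathcal{O}_L$-action on $H^1(A,\mathbb{Q})$; (2) $\eta(\sqrt{-d})^\dagger=-\eta(\sqrt{-d})$ for the Rosati involution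 $\dagger$; (3) $\eta(\sqrt{-d})$ acts on $H^{1,0}(A)$ with eigenvalues $\pm i\sqrt d$, each with multiplicity $3$. The Weil locus $\mathcal{W}_K\subset X_L$ is the set of $[A]$ with $A$ of Weil type for $K$, and its component $\mathcal{W}_K^{I^+,I^-}$ attached to a sign-assignment is the one on which $\eta(\sqrt{-d})$ acts by $+i\sqrt d$ on $H^{1,0}_{\sigma_i}$ for $i\in I^+$ and by $-i\sqrt d$ for $i\in I^-$.
   Formalization: In (iv), conjugating η swaps I⁺ and I⁻, so the 20 components give only 10 distinct subsets of X_L; the bijection is proved with the 20 components of the locus of isomorphism classes [A, η] over W_K, and components in W_K are shown to coincide exactly for equal or opposite signs. *)

(* Defs.v *)
From HB Require Import structures.
From mathcomp Require Import all_boot all_order all_algebra all_fingroup all_field.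
From mathcomp Require Import complex.
From mathcomp Require Import boolp classical_sets functions cardinality.
From mathcomp Require Import reals trigo.

Set Implicit Arguments.
Unset Strict Implicit.
Unset Printing Implicit Defensive.

Import Order.TTheory GRing.Theory Num.Theory.
Local Open Scope classical_set_scope.
Local Open Scope ring_scope.

Definition isqrt (R : realType) (d : nat) : R[i] := (0 +i* Num.sqrt d%:R)%C.

Definition conj_type (R : realType) (M : fieldExtType rat)
    (Phi : set {rmorphism M -> R[i]}) : set {rmorphism M -> R[i]} :=
  [set ((@conjc R) \o f : {rmorphism M -> R[i]}) | f in Phi].

Definition CM_type (R : realType) (M : fieldExtType rat)
    (Phi : set {rmorphism M -> R[i]}) : Prop :=
  [/\ (Phi #= `I_6)%card, Phi `&` conj_type Phi = set0
    & Phi `|` conj_type Phi = setT].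

(* f is the extension phi_i^+ (w = i sqrt d) or phi_i^- (w = - i sqrt d) of
   sigma_i, where s = sqrt(-d) in K. *)
Definition is_phi (R : realType) (M : fieldExtType rat) (K L : {subfield M})
    (s : subvs_of K) (sigma : 'I_6 -> {rmorphism subvs_of L -> R})
    (i : 'I_6) (w : R[i]) (f : {rmorphism M -> R[i]}) : Prop :=
  (forall x : subvs_of L, f (vsval x) = ((sigma i x)%:C)%C) /\ f (vsval s) = w.

Definition weil_compatible (R : realType) (d : nat) (M : fieldExtType rat)
    (K L : {subfield M}) (s : subvs_of K)
    (sigma : 'I_6 -> {rmorphism subvs_of L -> R})
    (Phi : set {rmorphism M -> R[i]}) : Prop :=
  CM_type Phi /\
  (Phi `&` [set f | exists i, is_phi s sigma i (isqrt R d) f] #= `I_3)%card.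

(* I = (I^+, I^-). *)
Definition sign_assignment : set ({set 'I_6} * {set 'I_6}) :=
  [set I | [/\ I.2 = ~: I.1, #|I.1| = 3%N & #|I.2| = 3%N]].

Definition CM_type_of_signs (R : realType) (d : nat) (M : fieldExtType rat)
    (K L : {subfield M}) (s : subvs_of K)
    (sigma : 'I_6 -> {rmorphism subvs_of L -> R})
    (I : {set 'I_6} * {set 'I_6}) : set {rmorphism M -> R[i]} :=
  [set f | exists2 i, i \in I.1 & is_phi s sigma i (isqrt R d) f] `|`
  [set f | exists2 i, i \in I.2 & is_phi s sigma i (- isqrt R d) f].

(* A complex abelian sixfold is a torus A = V / Lam, where V is the space of
    column vectors C^6.  Endomorphisms are the matrices u acting on V by
    v |-> u *m v that preserve Lam.  H^{1,0}(A) is the dual of V, the space of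
    row vectors, on which u acts by pull-back w |-> w *m u; this is why
    eigenspaces of u on H^{1,0}(A) are row eigenspaces.  H^1(A, Q) is
    Hom(Lam, Q), i.e. the R-linear forms on V that are rational on Lam. *)

Definition is_lattice (R : realType) (Lam : set 'cV[R[i]]_6) : Prop :=
  exists b : 'I_12 -> 'cV[R[i]]_6,
    (forall r : 'I_12 -> R,
       \sum_j ((r j)%:C)%C *: b j = 0 -> forall j, r j = 0) /\
    Lam = [set \sum_j ((m j)%:~R : R[i]) *: b j | m in [set: 'I_12 -> int]].

(* E is the real extension of the alternating form; polarization_unimod says
   that A -> A^dual, whose kernel is {u | E(u, Lam) in Z} / Lam, is an
   isomorphism. *)
Record principal_polarization (R : realType) (Lam : set 'cV[R[i]]_6)
    (E : 'cV[R[i]]_6 -> 'cV[R[i]]_6 -> R) : Prop := PrincipalPolarization {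
  polarizationD : forall u v w, E (u + v) w = E u w + E v w;
  polarizationZ : forall (r : R) u w, E ((r%:C)%C *: u) w = r * E u w;
  polarization_skew : forall u v, E u v = - E v u;
  polarization_i : forall u v, E ('i%C *: u) ('i%C *: v) = E u v;
  polarization_pos : forall u, u != 0 -> 0 < E ('i%C *: u) u;
  polarization_int : forall u v, Lam u -> Lam v -> E u v \is a Num.int;
  polarization_unimod :
    forall u, (forall v, Lam v -> E u v \is a Num.int) -> Lam u
}.

Definition is_End (R : realType) (Lam : set 'cV[R[i]]_6) (u : 'M[R[i]]_6) :=
  forall v, Lam v -> Lam (u *m v).

Definition is_End0 (R : realType) (Lam : set 'cV[R[i]]_6) (u : 'M[R[i]]_6) :=
  exists2 n : nat, (0 < n)%N & is_End Lam (u *+ n).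

(* u' is the Rosati image of u: the adjoint for E. *)
Definition is_rosati (R : realType) (E : 'cV[R[i]]_6 -> 'cV[R[i]]_6 -> R)
    (u u' : 'M[R[i]]_6) : Prop :=
  forall v w, E (u *m v) w = E v (u' *m w).

(* The action O_L -> End(A) is recorded through its unique extension
   L -> End^0(A).  O_L is the set of x : L integral over Z. *)
Record ppavRM (R : realType) (M : fieldExtType rat) (L : {subfield M}) :=
  PPAVRM {
    lat : set 'cV[R[i]]_6;
    pol : 'cV[R[i]]_6 -> 'cV[R[i]]_6 -> R;
    rm : {rmorphism subvs_of L -> 'M[R[i]]_6};
    lat_lattice : is_lattice lat;
    pol_principal : principal_polarization lat pol;
    rm_integral : forall x, integralOver intr x -> is_End lat (rm x);
    rm_symmetric : forall x, is_rosati pol (rm x) (rm x)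
  }.

Definition is_iso (R : realType) (M : fieldExtType rat) (L : {subfield M})
    (A B : ppavRM R L) (g : 'M[R[i]]_6) : Prop :=
  [/\ g \in unitmx,
      forall v, lat A v <-> lat B (g *m v),
      forall v w, pol B (g *m v) (g *m w) = pol A v w
    & forall x, g *m rm A x = rm B x *m g].

(* cls : A |-> [A] identifies X with the set of points of the coarse moduli
   space X_L.  Quantifying over X and cls covers H^6 / SL_2(O_L), for any choice
   of the parametrization, as well as the set of isomorphism classes. *)
Definition coarse_moduli (R : realType) (M : fieldExtType rat)
    (L : {subfield M}) (X : Type) (cls : ppavRM R L -> X) : Prop :=
  (forall x, exists A, cls A = x) /\
  (forall A B, cls A = cls B <-> exists g, is_iso A B g).

Definition is_H1Q (R : realType) (M : fieldExtType rat) (L : {subfield M})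
    (A : ppavRM R L) (h : 'cV[R[i]]_6 -> R) : Prop :=
  [/\ forall u v, h (u + v) = h u + h v,
      forall (r : R) v, h ((r%:C)%C *: v) = r * h v
    & forall v, lat A v -> exists q : rat, h v = ratr q].

Definition is_H10 (R : realType) (M : fieldExtType rat) (L : {subfield M})
    (A : ppavRM R L) (sg : {rmorphism subvs_of L -> R}) (w : 'rV[R[i]]_6) :=
  forall x, w *m rm A x = ((sg x)%:C)%C *: w.

Record weil_structure (R : realType) (d : nat) (M : fieldExtType rat)
    (K L : {subfield M}) (s : subvs_of K) (A : ppavRM R L)
    (eta : {rmorphism subvs_of K -> 'M[R[i]]_6}) : Prop := WeilStructure {
  weil_End0 : forall k, is_End0 (lat A) (eta k);
  weil_commute : forall a k, integralOver intr a ->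
    forall h, is_H1Q A h ->
    forall v, h (eta k *m (rm A a *m v)) = h (rm A a *m (eta k *m v));
  weil_rosati : is_rosati (pol A) (eta s) (- eta s);
  weil_eigen_pos : \rank (eigenspace (eta s) (isqrt R d)) = 3%N;
  weil_eigen_neg : \rank (eigenspace (eta s) (- isqrt R d)) = 3%N
}.

Definition weil_type (R : realType) (d : nat) (M : fieldExtType rat)
    (K L : {subfield M}) (s : subvs_of K) (A : ppavRM R L) : Prop :=
  exists eta, weil_structure d s A eta.

Definition has_signs (R : realType) (d : nat) (M : fieldExtType rat)
    (K L : {subfield M}) (s : subvs_of K)
    (sigma : 'I_6 -> {rmorphism subvs_of L -> R})
    (I : {set 'I_6} * {set 'I_6}) (A : ppavRM R L)
    (eta : {rmorphism subvs_of K -> 'M[R[i]]_6}) : Prop :=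
  (forall i w, i \in I.1 -> is_H10 A (sigma i) w ->
     w *m eta s = isqrt R d *: w) /\
  (forall i w, i \in I.2 -> is_H10 A (sigma i) w ->
     w *m eta s = - isqrt R d *: w).

Definition weil_locus (R : realType) (d : nat) (M : fieldExtType rat)
    (K L : {subfield M}) (s : subvs_of K) (X : Type) (cls : ppavRM R L -> X) :
    set X :=
  [set cls A | A in weil_type d s].

Definition weil_component (R : realType) (d : nat) (M : fieldExtType rat)
    (K L : {subfield M}) (s : subvs_of K)
    (sigma : 'I_6 -> {rmorphism subvs_of L -> R})
    (X : Type) (cls : ppavRM R L -> X) (I : {set 'I_6} * {set 'I_6}) : set X :=
  [set cls A | A in [set A | exists eta,
     weil_structure d s A eta /\ has_signs d s sigma I A eta]].

(* Replacing eta by its complex conjugate exchanges I^+ and I^-, so the subsets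
   of X attached to (I^+, I^-) and (I^-, I^+) coincide.  The sign-assignment is
   a function of the pair (A, eta), and the components indexed by
   sign-assignments are told apart in the locus of isomorphism classes
   [A, eta], which lies over the Weil locus. *)
Definition ppavRMK (R : realType) (M : fieldExtType rat) (K L : {subfield M})
    : Type :=
  (ppavRM R L * {rmorphism subvs_of K -> 'M[R[i]]_6})%type.

Definition iso_class (R : realType) (M : fieldExtType rat)
    (K L : {subfield M}) (p : ppavRMK R K L) : set (ppavRMK R K L) :=
  [set q : ppavRMK R K L | exists2 g, is_iso p.1 q.1 g &
     forall k, g *m p.2 k = q.2 k *m g].

Definition oriented_weil_locus (R : realType) (d : nat)
    (M : fieldExtType rat) (K L : {subfield M}) (s : subvs_of K) :
    set (set (ppavRMK R K L)) :=
  [set iso_class p | p in [set p : ppavRMK R K L | weil_structure d s p.1 p.2]].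

Definition oriented_component (R : realType) (d : nat)
    (M : fieldExtType rat) (K L : {subfield M}) (s : subvs_of K)
    (sigma : 'I_6 -> {rmorphism subvs_of L -> R})
    (I : {set 'I_6} * {set 'I_6}) : set (set (ppavRMK R K L)) :=
  [set iso_class p | p in [set p : ppavRMK R K L |
     weil_structure d s p.1 p.2 /\ has_signs d s sigma I p.1 p.2]].

(* The characters through which M = KL acts on H^{1,0}(A). *)
Definition CM_type_of (R : realType) (M : fieldExtType rat)
    (K L : {subfield M}) (p : ppavRMK R K L) : set {rmorphism M -> R[i]} :=
  [set f | exists2 w : 'rV[R[i]]_6, w != 0 &
     (forall x, w *m rm p.1 x = f (vsval x) *: w) /\
     (forall k, w *m p.2 k = f (vsval k) *: w)].

(* Main.v *)
Require Import Defs.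
From HB Require Import structures.
From mathcomp Require Import all_boot all_order all_algebra all_fingroup all_field.
From mathcomp Require Import complex.
From mathcomp Require Import boolp classical_sets functions cardinality.
From mathcomp Require Import reals trigo.
From mathcomp Require Import ring lra.

Set Implicit Arguments.
Unset Strict Implicit.
Unset Printing Implicit Defensive.

Import Order.TTheory GRing.Theory Num.Theory.
Local Open Scope classical_set_scope.
Local Open Scope ring_scope.

(** Write [zeta] for a primitive root of unity of order 42, so that [L] is generated
by [c = (zeta + zeta^-1) / 2]. CM types and Weil structures are both
determined by signs indexed by the six real embeddings of [L].

The field. The quadratic Gauss sums modulo 3 and 7 are combinations of the
[sin (n pi / 21)], hence products of [sin (pi / 21)] by elements of [L]. So
[zeta = c + s y] with [y] in [L], and [M = K L] is generated by [zeta]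
([exists_root42]). The cyclotomic polynomial is irreducible, so [M] has degree 12,
and its Galois group is the group of units modulo 42 ([gal_isog]). An embedding of
[M] is real on [L] and is therefore determined by some [sigma i] and by the sign
of the image of [s]; there are 12 automorphisms and 12 such pairs, so every pair
occurs ([exists_emb]).

CM types. Complex conjugation changes the sign and keeps the index, so a CM type is
a choice of one sign for each index, i.e. a subset of the six indices ([CM_typeP]).
It is compatible with [K] when the subset has three elements, and conjugation is
complementation ([card_CM_types]).

From an abelian variety to signs. The endomorphisms act on the lattice by rational
matrices, and this forces all six characters of [L] to occur on the space
[H^{1,0}], each on a line ([eigenbasis]). A Weil structure [eta] commutes with
[L], so it preserves the lines, and on each of them [eta s] is one of the two
square roots of [- d] ([diagonal_form_on]). The six signs are at once the sign-assignment of the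
pair [(A, eta)] and its CM type, and they depend only on its isomorphism class.
This gives the disjoint decomposition of the oriented locus.

From signs to an abelian variety. The components are nonempty by an explicit
construction ([exists_weil_structure]): by density of [L] in [R^6] there is [rho] in
[L] with prescribed signs ([prescribed_signs]), and multiplication by [s] with
prescribed signs preserves [L + s rho L], in which the lattice
[s rho O_L + O_L^dual] is principally polarized. Its periods need an integral basis
of [L] ([integral_basis]).

Forgetting [eta]. Two Weil structures on one variety have signs that agree
everywhere or nowhere, because the product of the two actions of [s] comes from an
element of [L] whose conjugates are all [d] or [- d] ([weil_signs_unique]).
Conversely the conjugation of [K] turns [eta] into a Weil structure with the
opposite signs ([weil_structure_conj]). *)

(** * Generalities *)

Lemma rmorph_ext (A B : pzSemiRingType) (f g : {rmorphism A -> B}) :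
  f =1 g -> f = g.
Proof.
case: f g => [f cf] [g cg] /= /funext eqfg; move: cf cg; rewrite {}eqfg => cf cg.
congr GRing.RMorphism.Pack; case: cf cg => [[a] [b]] [[a'] [b']].
by rewrite (Prop_irrelevance a a') (Prop_irrelevance b b').
Qed.

Lemma card_finset (T : finType) (A : {set T}) : ([set` A] #= `I_#|A|)%card.
Proof.
have /inj_card_eq : {in [set` A] &, injective (fun x => index x (enum A))}.
  move=> x y; rewrite !inE /= => Ax Ay; apply: index_inj; rewrite ?mem_enum //.
rewrite card_eq_sym => /card_eq_trans; apply.
rewrite (_ : _ @` _ = `I_#|A|) //; apply/seteqP; split=> [_ [x Ax <-]|k] /=.
  by rewrite cardE index_mem mem_enum.
rewrite cardE => ltk; have [x0 _|A0] := pickP (mem A); last first.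
  by move: ltk; rewrite -cardE eq_card0.
exists (nth x0 (enum A) k); last by rewrite index_uniq ?enum_uniq.
by rewrite /= -mem_enum mem_nth.
Qed.

Lemma card_imset_inj (T : finType) (U : Type) (A : {set T}) (f : T -> U) :
  {in A &, injective f} -> ([set f x | x in [set` A]] #= `I_#|A|)%card.
Proof.
move=> injf; apply: card_eq_trans (card_finset A).
by apply: inj_card_eq => x y; rewrite !inE /= => *; apply: injf.
Qed.

Lemma card_half_complement (T : finType) (i0 : T) (P : pred {set T}) :
    (forall S, P (~: S) = P S) ->
  #|[set S : {set T} | P S]%SET| = (#|[set S : {set T} | P S & i0 \in S]%SET|).*2.
Proof.
move=> PC; rewrite -(cardsID [set S : {set T} | i0 \in S]%SET [set S | P S]%SET) -addnn.
congr (_ + _)%N; first by apply: eq_card => S; rewrite !inE.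
rewrite -(card_imset _ (@finset.setC_inj T)); apply: eq_card => S; rewrite !inE.
apply/imsetP/idP => [[S1]|/andP[PS i0S]].
  by rewrite !inE => /andP[i0S1 PS1] ->; rewrite PC PS1 inE.
by exists (~: S); rewrite ?finset.setCK // !inE PC PS i0S.
Qed.

(** * Rational combinations of powers of a generator *)

Section RationalCoefficients.
Variables (F : fieldExtType rat).

Definition evalq (p : {poly rat}) (x : F) : F := (map_poly (in_alg F) p).[x].

Lemma rmorph_evalq (B : unitRingType) (f : {rmorphism F -> B}) p x :
  f (evalq p x) = (map_poly (ratr : rat -> B) p).[f x].
Proof.
rewrite /evalq -horner_map -map_poly_comp; congr (_.[_]).
by apply: eq_map_poly => q /=; rewrite -[q%:A]/(in_alg F q) (fmorph_eq_rat (in_alg F)) fmorph_rat.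
Qed.

End RationalCoefficients.

Lemma integralOver_rmorph (A B : fieldType) (f : {rmorphism A -> B}) (x : A) :
  integralOver intr x <-> integralOver intr (f x).
Proof.
have eq_fp p : map_poly (intr : int -> B) p = map_poly f (map_poly intr p).
  by rewrite -map_poly_comp; apply: eq_map_poly => m /=; rewrite rmorph_int.
by split=> -[p monp px0]; exists p; move: px0 => //; rewrite eq_fp fmorph_root.
Qed.

(** The rational root theorem, read off from the algebraic integers of algC. *)
Lemma rat_integral_int (q : rat) :
  integralOver intr q -> exists m : int, q = m%:~R.
Proof.
move=> intq; apply/intrP; rewrite -Cint_rat; apply: Cint_rat_Aint.
  exact: rpred_rat.
have /(integralOver_rmorph (ratr : {rmorphism rat -> algC}))[p monp] := intq.
move/root_monic_Aint; apply; first exact: monic_map.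
by apply/polyOverP => i; rewrite coef_map /= intr_int.
Qed.

(** * Totally real number fields *)

Section TotallyReal.

Variables (R : realType) (F : fieldExtType rat) (n' : nat).
Local Notation n := n'.+1.
Variables (sigma : 'I_n -> {rmorphism F -> R}) (c : F).
Hypothesis sigma_c_inj : injective (fun i => sigma i c).
Hypothesis cP : forall x, exists2 p : {poly rat}, (size p <= n)%N & x = evalq p c.
Hypothesis intc : integralOver intr c.

Local Notation ratR := (ratr : rat -> R).
Local Notation "A ^Q" := (map_mx ratR A) (at level 2, format "A ^Q").

Definition conjugates (e : 'I_n -> F) : 'M[R]_n := \matrix_(i, j) sigma i (e j).
Definition conj_diag (x : F) : 'M[R]_n := diag_mx (\row_i sigma i x).
Definition power_family (k : 'I_n) : F := c ^+ k.

Lemma conjugates_powers_unit : conjugates power_family \in unitmx.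
Proof.
have -> : conjugates power_family = (Vandermonde n (\row_i sigma i c))^T.
  by apply/matrixP=> i j; rewrite !mxE rmorphXn.
rewrite unitmx_tr unitmxE det_Vandermonde unitfE.
apply/prodf_neq0 => i _; apply/prodf_neq0 => j ltij; rewrite !mxE subr_eq0.
by apply: contraTneq ltij => /sigma_c_inj ->; rewrite ltnn.
Qed.

Lemma coords_powers x :
  exists a : 'cV[rat]_n, x = \sum_k a k 0 *: power_family k.
Proof.
have [p szp ->] := cP x; exists (\col_k p`_k).
rewrite /evalq (@horner_coef_wide _ n) ?size_map_poly //.
by apply: eq_bigr => k _; rewrite coef_map mxE /= mulr_algl.
Qed.

Lemma sigma_scale i q x : sigma i (q *: x) = ratr q * sigma i x.
Proof.
rewrite -mulr_algl rmorphM; congr (_ * _).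
by rewrite -[q%:A]/(in_alg F q) (fmorph_eq_rat (in_alg F)) fmorph_rat.
Qed.

Lemma sigma_comb i (a : 'cV[rat]_n) (e : 'I_n -> F) :
  sigma i (\sum_k a k 0 *: e k) = (conjugates e *m a^Q) i 0.
Proof.
rewrite rmorph_sum mxE; apply: eq_bigr => k _.
by rewrite sigma_scale !mxE mulrC.
Qed.

Lemma conjugates_comb (A : 'M[rat]_n) (e f : 'I_n -> F) :
  (forall j, f j = \sum_k A k j *: e k) -> conjugates f = conjugates e *m A^Q.
Proof.
move=> fE; apply/matrixP => i j; rewrite mxE fE.
have -> : \sum_k A k j *: e k = \sum_k (col j A) k 0 *: e k.
  by apply: eq_bigr => k _; rewrite mxE.
by rewrite sigma_comb !mxE; apply: eq_bigr => k _; rewrite !mxE.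
Qed.

Lemma family_powers (f : 'I_n -> F) :
  exists A : 'M[rat]_n, forall j, f j = \sum_k A k j *: power_family k.
Proof.
have [a aP] := fin_all_exists (fun j => coords_powers (f j)).
exists (\matrix_(k, j) a j k 0) => j; rewrite aP.
by apply: eq_bigr => k _; rewrite mxE.
Qed.

Lemma conj_diagM x e : conj_diag x *m conjugates e = conjugates (fun j => x * e j).
Proof. by apply/matrixP => i j; rewrite mul_diag_mx !mxE rmorphM. Qed.

(** Multiplication by [x] has a rational matrix in the basis of powers of [c],
and this matrix is conjugate over the reals to the diagonal matrix of the
[sigma i x]. *)
Lemma trace_rat x : exists q : rat, \sum_i sigma i x = ratr q.
Proof.
have [A fE] := family_powers (fun j => x * power_family j).
have := conjugates_comb fE; rewrite -conj_diagM; set V := conjugates _ => VE.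
have Vu := conjugates_powers_unit.
exists (\tr A).
have -> : \sum_i sigma i x = \tr (conj_diag x).
  by rewrite mxtrace_diag; apply: eq_bigr => i _; rewrite mxE.
rewrite -[conj_diag x](mulmxK Vu) VE -mulmxA mxtrace_mulC -mulmxA mulVmx //.
rewrite mulmx1 /mxtrace rmorph_sum; by apply: eq_bigr => i _; rewrite mxE.
Qed.

Lemma integral_sum_sigma x :
  integralOver intr x -> exists m : int, \sum_i sigma i x = m%:~R.
Proof.
move=> intx; have [q Dq] := trace_rat x.
have : integralOver intr (ratR q).
  rewrite -Dq; elim/big_ind: _ => [|u v|i _].
  - exact: integral0.
  - exact: integral_add.
  - exact/(integralOver_rmorph (sigma i)).
move/(integralOver_rmorph (ratr : {rmorphism rat -> R})).
by case/rat_integral_int => m Dm; exists m; rewrite Dq Dm ratr_int.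
Qed.

Lemma conjugates_tr_mul e f :
  (conjugates e)^T *m conjugates f = \matrix_(i, j) \sum_k sigma k (e i * f j).
Proof.
by apply/matrixP => i j; rewrite !mxE; apply: eq_bigr => k _; rewrite !mxE rmorphM.
Qed.

Lemma gram_rat e f : exists G, (conjugates e)^T *m conjugates f = G^Q.
Proof.
have [g gP] := fin_all_exists (fun ij => trace_rat (e ij.1 * f ij.2)).
exists (\matrix_(i, j) g (i, j)); rewrite conjugates_tr_mul.
by apply/matrixP => i j; rewrite !mxE -gP.
Qed.

Lemma coords_family e x : conjugates e \in unitmx ->
  exists a : 'cV[rat]_n, x = \sum_k a k 0 *: e k.
Proof.
move=> eu; have [A eA] := family_powers e; have [a ->] := coords_powers x.
have eV := conjugates_comb eA.
have Au : A \in unitmx by rewrite -(map_unitmx ratR); move: eu; rewrite eV unitmx_mul => /andP[].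
exists (invmx A *m a); apply: (fmorph_inj (sigma ord0)).
by rewrite !sigma_comb eV map_mxM mulmxA -(mulmxA _ A^Q) -map_mxM mulmxV // map_mx1 mulmx1.
Qed.

(** The square of the determinant of the conjugates is the determinant of the
matrix of traces of products. This is what makes the ring of integers discrete. *)
Lemma integral_discr e : (forall j, integralOver intr (e j)) ->
  exists m : int, \det (conjugates e) ^+ 2 = m%:~R.
Proof.
move=> inte.
have [g gP] := fin_all_exists (fun ij : 'I_n * 'I_n =>
  integral_sum_sigma (integral_mul (inte ij.1) (inte ij.2))).
exists (\det (\matrix_(i, j) g (i, j))).
rewrite expr2 -{1}det_tr -det_mulmx conjugates_tr_mul -det_map_mx; congr (\det _).
by apply/matrixP => i j; rewrite !mxE; exact: (gP (i, j)).
Qed.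

(** A family of integers with nonzero discriminant of least absolute value is an
integral basis: if an integer had a coordinate [q] outside [int], replacing the
corresponding member of the family by the fractional part would multiply the
discriminant by the square of the fractional part of [q]. *)
Lemma integral_basis : exists e : 'I_n -> F,
  [/\ forall j, integralOver intr (e j), conjugates e \in unitmx
    & forall x, integralOver intr x -> exists m : 'I_n -> int, x = \sum_j e j *~ m j].
Proof.
pose P (N : nat) := exists e : 'I_n -> F, [/\ forall j, integralOver intr (e j),
  conjugates e \in unitmx & \det (conjugates e) ^+ 2 = N%:R].
have discr_nat e : (forall j, integralOver intr (e j)) ->
    exists N : nat, \det (conjugates e) ^+ 2 = N%:R.
  move=> /integral_discr[m Dm]; exists `|m|%N; rewrite Dm pmulrn gez0_abs //.
  by rewrite -(ler0z R) -Dm sqr_ge0.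
have exP : exists N, `[< P N >].
  have intp j : integralOver intr (power_family j).
    rewrite /power_family; elim: (j : nat) => [|k IHk]; first exact: integral1.
    by rewrite exprS; apply: integral_mul.
  have [N DN] := discr_nat _ intp; exists N; apply/asboolP; exists power_family.
  by split=> //; exact: conjugates_powers_unit.
case: (ex_minnP exP) => N /asboolP[e [inte eu DN]] minN; exists e; split=> // x intx.
have [a xE] := coords_family x eu.
suffices aint k : a k 0 \is a Num.int.
  exists (fun k => Num.floor (a k 0)); rewrite xE; apply: eq_bigr => k _.
  by rewrite -{1}[a k 0]floorK // scaler_int.
apply: contraT => nint; pose m := Num.floor (a k 0); pose q := a k 0 - m%:~R.
have /andP[q_ge0 q_lt1] : 0 < q < 1.
  rewrite subr_gt0 lt_neqAle Num.Theory.ge_floor andbT ltrBlDl [_ + 1](_ : _ = (m + 1)%:~R).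
    by rewrite Num.Theory.lt_succ_floor andbT; apply: contraNneq nint => <-; rewrite intr_int.
  by rewrite rmorphD.
pose f j := if j == k then x - e k *~ m else e j.
have intf j : integralOver intr (f j).
  rewrite /f; case: eqP => // _; apply: integral_sub => //.
  by rewrite -mulrzr; apply: integral_mul => //; apply: integral_id.
have detf : \det (conjugates f) = ratr q * \det (conjugates e).
  pose A : 'M[rat]_n := \matrix_(i, j) if j == k then a i 0 - m%:~R *+ (i == k) else (i == j)%:R.
  have -> : conjugates f = conjugates e *m A^Q.
    apply: conjugates_comb => j; rewrite /f; case: eqP => [->|/eqP jk].
      rewrite [X in X - _]xE -(scaler_int m) [X in X - _](bigD1 k) // [RHS](bigD1 k) //= addrAC.
      rewrite [A k k]mxE !eqxx scalerBl; congr (_ + _); apply: eq_bigr => i ik.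
      by rewrite mxE eqxx (negPf ik) subr0.
    rewrite (bigD1 j) //= mxE (negPf jk) eqxx scale1r big1 ?addr0 // => i ij.
    by rewrite mxE (negPf jk) (negPf ij) scale0r.
  rewrite det_mulmx mulrC det_map_mx; congr (ratr _ * _).
  rewrite (expand_det_row _ k) (bigD1 k) //= big1 => [|j jk]; last first.
    by rewrite mxE (negPf jk) eq_sym (negPf jk) mul0r.
  rewrite addr0 mxE !eqxx /cofactor addnn -mul2n exprM sqrrN expr1n mul1r.
  rewrite (_ : row' k _ = 1%:M) ?det1 ?mulr1 //.
  apply/matrixP => i j; rewrite !mxE (inj_eq lift_inj) eq_sym.
  by rewrite -if_neg neq_lift.
have [N1 DN1] := discr_nat f intf.
have nz_det : \det (conjugates e) != 0 by rewrite -unitfE -unitmxE.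
have fu : conjugates f \in unitmx.
  by rewrite unitmxE detf unitfE mulf_neq0 // fmorph_eq0 gt_eqF.
have N1N : N1%:R = ratr q ^+ 2 * N%:R :> R by rewrite -DN1 -DN detf exprMn.
have /minN : `[< P N1 >] by apply/asboolP; exists f.
have N_gt0 : 0 < N%:R :> R.
  by rewrite -DN lt_neqAle sqr_ge0 andbT eq_sym expf_neq0.
rewrite -(ler_nat R) N1N ler_pMl // leNgt => /negP[].
by rewrite expr_lt1 ?ler0q ?ltW // -[1](rmorph1 ratR) ltr_rat.
Qed.

(** The conjugates of the powers of [c] are a basis of the real vector space
[R^n], and their rational combinations are dense in it. *)
Lemma weak_approximation (t : 'I_n -> R) :
  exists x, forall i, `|sigma i x - t i| < 1.
Proof.
pose V := conjugates power_family.
have [r Vr] : exists r : 'cV[R]_n, V *m r = \col_i t i.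
  by exists (invmx V *m \col_i t i); rewrite mulKVmx ?conjugates_powers_unit.
pose S := 1 + \sum_i \sum_j `|V i j|.
have S_gt0 : 0 < S.
  by rewrite ltr_pwDl // sumr_ge0 // => i _; rewrite sumr_ge0.
have /fin_all_exists[q qP] j : exists q, `|ratR q - r j 0| < S^-1.
  have [|q] := @rat_in_itvoo R (r j 0 - S^-1) (r j 0 + S^-1).
    by rewrite ltrD2l gtrN ?invr_gt0.
  by rewrite in_itv /= => ?; exists q; rewrite ltr_distl.
exists (\sum_k q k *: power_family k) => i.
have -> : \sum_k q k *: power_family k = \sum_k (\col_k q k) k 0 *: power_family k.
  by apply: eq_bigr => k _; rewrite mxE.
rewrite sigma_comb -/V.
have -> : t i = (V *m r) i 0 by rewrite Vr mxE.
rewrite !mxE -sumrB (le_lt_trans (ler_norm_sum _ _ _)) //.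
apply: (@le_lt_trans _ _ (\sum_j `|V i j| * S^-1)).
  apply: ler_sum => j _; rewrite !mxE -mulrBr normrM ler_wpM2l //.
  by rewrite ltW.
rewrite -mulr_suml ltr_pdivrMr // mul1r /S [\sum_i0 _](bigD1 i) //=.
rewrite addrCA ltrDl ltr_pwDl // sumr_ge0 // => j _; exact: sumr_ge0.
Qed.

Lemma prescribed_signs (b : 'I_n -> bool) :
  exists x, forall i, 0 < (-1) ^+ b i * sigma i x.
Proof.
have [x xP] := weak_approximation (fun i => (-1) ^+ b i); exists x => i.
move: (xP i); case: (b i); rewrite ltr_norml => /andP[]; lra.
Qed.

End TotallyReal.

(** * Lattices and rational endomorphisms *)

Section Lattices.

Variable R : realType.
Local Notation C := R[i].
Local Notation RtoC := (real_complex R).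
Local Notation "A ^RC" := (map_mx RtoC A) (at level 2, format "A ^RC").

Definition mx_Re m n (A : 'M[C]_(m, n)) : 'M[R]_(m, n) := map_mx (@complex.Re R) A.
Definition mx_Im m n (A : 'M[C]_(m, n)) : 'M[R]_(m, n) := map_mx (@complex.Im R) A.

(** In this form of [is_lattice] the endomorphisms of the torus become matrices of
size 12, through [u *m Bm = Bm *m A]. *)
Definition lattice_basis (Lam : set 'cV[C]_6) (Bm : 'M[C]_(6, 12)) :=
  (forall r : 'cV[R]_12, Bm *m r^RC = 0 -> r = 0) /\
  (forall v, Lam v <-> exists m : 'cV[int]_12, v = Bm *m map_mx intr m).

Lemma mulmx_comb (b : 'I_12 -> 'cV[C]_6) (r : 'I_12 -> C) :
  (\matrix_(i, j) b j i 0) *m (\col_j r j) = \sum_j r j *: b j.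
Proof.
apply/matrixP => i k; rewrite ord1 mxE summxE; apply: eq_bigr => j _.
by rewrite !mxE mulrC.
Qed.

Lemma is_latticeP Lam : is_lattice Lam <-> exists Bm, lattice_basis Lam Bm.
Proof.
split=> [[b [freeb ->]]|[Bm [freeB LamE]]].
  exists (\matrix_(i, j) b j i 0); split=> [r|v].
    rewrite (_ : r^RC = \col_j RtoC (r j 0)); last first.
      by apply/matrixP => i j; rewrite ord1 !mxE.
    by rewrite mulmx_comb => /freeb r0; apply/matrixP => i j; rewrite ord1 r0 mxE.
  split=> [[m _ <-]|[m ->]].
    exists (\col_j m j); rewrite -mulmx_comb; congr (_ *m _).
    by apply/matrixP => i j; rewrite !mxE.
  exists (fun j => m j 0) => //; rewrite -mulmx_comb; congr (_ *m _).
  by apply/matrixP => i j; rewrite !mxE ord1.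
have BE : Bm = \matrix_(i, j) (col j Bm) i 0 by apply/matrixP => i j; rewrite !mxE.
exists (fun j => col j Bm); split=> [r|].
  rewrite -mulmx_comb -BE (_ : \col_j _ = (\col_j r j)^RC); last first.
    by apply/matrixP => i j; rewrite !mxE.
  by move=> /freeB /matrixP r0 j; have := r0 j 0; rewrite !mxE.
apply/seteqP; split=> v /=.
  move=> /LamE[m ->]; exists (fun j => m j 0) => //.
  rewrite -mulmx_comb -BE; congr (_ *m _).
  by apply/matrixP => i j; rewrite !mxE ord1.
move=> [m _ <-]; apply/LamE; exists (\col_j m j).
rewrite -mulmx_comb -BE; congr (_ *m _).
by apply/matrixP => i j; rewrite !mxE.
Qed.

Lemma ReD : {morph (@complex.Re R) : x y / x + y}.
Proof. by case=> [a b] [a' b']. Qed.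
Lemma ImD : {morph (@complex.Im R) : x y / x + y}.
Proof. by case=> [a b] [a' b']. Qed.
Lemma ReMr (x : C) r : complex.Re (x * RtoC r) = complex.Re x * r.
Proof. by case: x => a b /=; rewrite mulr0 subr0. Qed.
Lemma ImMr (x : C) r : complex.Im (x * RtoC r) = complex.Im x * r.
Proof. by case: x => a b /=; rewrite mulr0 add0r. Qed.

(** The real coordinates of complex vectors: a lattice basis is a basis of the
underlying real vector space of dimension 12. *)
Definition realify n (v : 'M[C]_(6, n)) : 'M[R]_(12, n) := col_mx (mx_Re v) (mx_Im v).

Lemma realify_inj n : injective (@realify n).
Proof.
move=> v w vw; have [/matrixP reE /matrixP imE] := @eq_col_mx _ 6 6 n _ _ _ _ vw; apply/matrixP => i j.
have := reE i j; have := imE i j; rewrite !mxE.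
by case: (v i j) (w i j) => [? ?] [? ?] /= -> ->.
Qed.

Lemma realifyM k n (B : 'M[C]_(6, n)) (r : 'M[R]_(n, k)) :
  realify (B *m r^RC) = realify B *m r.
Proof.
rewrite /realify (@mul_col_mx _ 6 6); apply: (congr2 (@col_mx R 6 6 k));
  apply/matrixP => i j; rewrite !mxE.
  rewrite (big_morph _ ReD (erefl _)).
  by apply: eq_bigr => l _; rewrite !mxE ReMr.
rewrite (big_morph _ ImD (erefl _)).
by apply: eq_bigr => l _; rewrite !mxE ImMr.
Qed.

Lemma realify0 n : realify (0 : 'M_(6, n)) = 0.
Proof.
rewrite -[RHS](@vsubmxK _ 6 6 n); apply: (congr2 (@col_mx R 6 6 n));
  by apply/matrixP => i j; rewrite !mxE.
Qed.

Section Basis.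

Variables (Lam : set 'cV[C]_6) (Bm : 'M[C]_(6, 12)).
Hypothesis LamB : lattice_basis Lam Bm.

Lemma realify_basis_unit : realify Bm \in unitmx.
Proof.
rewrite -unitmx_tr -row_free_unit; apply: inj_row_free => v v0.
apply: trmx_inj; rewrite trmx0; apply: LamB.1; apply: realify_inj.
by rewrite realifyM realify0 -[LHS]trmxK trmx_mul trmxK v0 trmx0.
Qed.

Lemma basis_inj k (X Y : 'M[R]_(12, k)) : Bm *m X^RC = Bm *m Y^RC -> X = Y.
Proof.
by move/(congr1 (@realify k)); rewrite !realifyM => /(can_inj (mulKmx realify_basis_unit)).
Qed.

Lemma basis_span k (V : 'M[C]_(6, k)) : exists X : 'M[R]_(12, k), V = Bm *m X^RC.
Proof.
exists (invmx (realify Bm) *m realify V); apply: realify_inj.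
by rewrite realifyM mulKVmx // realify_basis_unit.
Qed.

Lemma basis_cancel k (u v : 'M[C]_(k, 6)) : u *m Bm = v *m Bm -> u = v.
Proof.
move=> uv; have [X X1] := basis_span 1%:M.
by rewrite -[u]mulmx1 -[v]mulmx1 X1 !mulmxA uv.
Qed.

Definition rational_rep (u : 'M[C]_6) (A : 'M[rat]_12) := u *m Bm = Bm *m map_mx ratr A.

Lemma ratr_mx m n (A : 'M[rat]_(m, n)) :
  map_mx (ratr : rat -> C) A = (map_mx ratr A)^RC.
Proof. by apply/matrixP => i j; rewrite !mxE fmorph_rat. Qed.

Lemma End0_rep u : is_End0 Lam u -> exists A, rational_rep u A.
Proof.
move=> [n n_gt0 endu].
have colE j : exists m : 'cV[int]_12, (u *+ n) *m col j Bm = Bm *m map_mx intr m.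
  apply/LamB.2; apply: endu; apply/LamB.2; exists (delta_mx j 0).
  rewrite matrix.colE; congr (_ *m _); apply/matrixP => i k; rewrite !mxE.
  by case: (_ && _).
have [m mE] := fin_all_exists colE.
exists (\matrix_(i, j) ((m j i 0)%:~R / n%:R)).
have n_neq0 : n%:R != 0 :> C by rewrite pnatr_eq0 -lt0n.
apply: (scalerI n_neq0); rewrite scalemxAl scalemxAr scaler_nat.
apply/matrixP => i j; have /matrixP/(_ i 0) := mE j.
rewrite matrix.colE mulmxA -matrix.colE mxE => ->; rewrite !mxE; apply: eq_bigr => k _.
by rewrite !mxE fmorph_div /= ratr_int ratr_nat (mulrCA n%:R) divff // mulr1.
Qed.

Lemma clear_denominators m n (A : 'M[rat]_(m, n)) :
  exists2 d : nat, (0 < d)%N & exists Z : 'M[int]_(m, n), A *+ d = map_mx intr Z.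
Proof.
pose den i j := `|denq (A i j)|%N.
exists (\prod_i \prod_j den i j)%N.
  by apply: prodn_gt0 => i; apply: prodn_gt0 => j; rewrite absz_gt0 denq_neq0.
exists (\matrix_(i, j) (numq (A i j) * (\prod_(k | k != j) den i k *
  \prod_(k | k != i) \prod_l den k l)%N%:Z)).
apply/matrixP => i j; rewrite !mxE mulmxnE (bigD1 i) //= (bigD1 j) //= -mulnA.
rewrite rmorphM /= -[in LHS](mulr_natr (A i j)) natrM mulrA; congr (_ * _).
rewrite /den [RHS]numqE; congr (_ * _); rewrite natr_absz.
by rewrite gtr0_norm ?denq_gt0.
Qed.

Lemma rep_End0 u A : rational_rep u A -> is_End0 Lam u.
Proof.
move=> uA; have [d d_gt0 [Z AZ]] := clear_denominators A; exists d => // v.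
move=> /LamB.2[m ->]; apply/LamB.2; exists (Z *m m).
rewrite map_mxM !mulmxA; congr (_ *m _).
rewrite -scaler_nat -scalemxAl uA scalemxAr; congr (_ *m _).
have -> : map_mx (intr : int -> C) Z = map_mx ratr (A *+ d).
  by rewrite AZ; apply/matrixP => i j; rewrite !mxE ratr_int.
by apply/matrixP => i j; rewrite !mxE mulmxnE rmorphMn mulr_natl.
Qed.

Lemma horner_mx_intertwine (u : 'M[C]_6) (A : 'M[C]_12) (p : {poly C}) :
  u *m Bm = Bm *m A -> horner_mx u p *m Bm = Bm *m horner_mx A p.
Proof.
move=> uB; elim/poly_ind: p => [|p a IHp]; first by rewrite !rmorph0 mul0mx mulmx0.
rewrite !rmorphD !rmorphM /= !horner_mx_X !horner_mx_C mulmxDl mulmxDr.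
rewrite -!mulmxE -mulmxA uB !mulmxA IHp; congr (_ + _).
by rewrite mul_scalar_mx mul_mx_scalar.
Qed.

(** Seen on the lattice, the powers of [u] and [y] are rational matrices, and a
linear relation over the reals between rational matrices descends to the rational
numbers. *)
Lemma rational_polynomial u y A Y (p : {poly R}) k :
    rational_rep u A -> rational_rep y Y -> (size p <= k)%N ->
    y = horner_mx u (map_poly RtoC p) ->
  exists2 q : {poly rat}, (size q <= k)%N & y = horner_mx u (map_poly ratr q).
Proof.
move=> uA yY szp yE; rewrite /rational_rep !ratr_mx in uA yY.
have YE : map_mx ratr Y = horner_mx (map_mx ratr A : 'M[R]_12) p.
  apply: basis_inj; rewrite -yY yE map_horner_mx.
  exact: horner_mx_intertwine.
have : (mxvec Y <= powers_mx A k)%MS.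
  rewrite -(map_submx (ratr : {rmorphism rat -> R})) map_mxvec map_powers_mx YE.
  rewrite -(poly_rV_K szp) horner_rVpoly vec_mxK; exact: submxMl.
case/submxP => a Ya; exists (rVpoly a); first exact: size_poly.
apply: basis_cancel; rewrite yY (horner_mx_intertwine _ uA) -ratr_mx.
rewrite -ratr_mx -map_horner_mx; congr (_ *m map_mx _ _).
by rewrite horner_rVpoly -Ya mxvecK.
Qed.

End Basis.
End Lattices.

(** * Simultaneous diagonalization *)

Section DiagonalForms.

Variables (F : fieldType).

Lemma row_diag_mul n m (d : 'rV[F]_n) (W : 'M_(n, m)) i :
  row i (diag_mx d *m W) = d 0 i *: row i W.
Proof. by apply/rowP => j; rewrite mul_diag_mx !mxE. Qed.

Lemma rank_diag_mx n (d : 'rV[F]_n) :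
  \rank (diag_mx d) = #|[set i | d 0 i != 0]%SET|.
Proof.
rewrite cardsE -sum1_card big_mkcond /=.
elim: n d => [|n IHn] d; first by rewrite big_ord0; apply/eqP; rewrite -leqn0 rank_leq_row.
move: d; rewrite -[n.+1]/(1 + n)%N => d.
pose l := lsubmx d; pose r := rsubmx d.
have -> : diag_mx d = block_mx (diag_mx l) 0 0 (diag_mx r).
  by rewrite -diag_mx_row hsubmxK.
rewrite rank_diag_block_mx IHn big_split_ord /= big_ord1; congr (_ + _)%N.
  rewrite rank_rV unfold_in -[diag_mx l == 0](_ : (d 0 (lshift n ord0) == 0) = _).
    by case: (_ == 0).
  apply/eqP/eqP => [d0|/matrixP/(_ 0 0)]; last by rewrite !mxE.
  by apply/matrixP => i j; rewrite !ord1 !mxE d0.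
by apply: eq_bigr => i _; rewrite !unfold_in mxE.
Qed.

Lemma rank_eigenspace_diag n (W g : 'M[F]_n) (e : 'rV_n) a :
    W \in unitmx -> W *m g = diag_mx e *m W ->
  \rank (eigenspace g a) = #|[set i | e 0 i == a]%SET|.
Proof.
move=> Wu Wg; rewrite mxrank_ker.
have -> : \rank (g - a%:M) = \rank (diag_mx (\row_i (e 0 i - a))).
  have [Wfree Wfull] : row_free W /\ row_full W by rewrite row_free_unit row_full_unit.
  rewrite -[RHS](mxrankMfree _ Wfree) -[LHS](eqmxMfull _ Wfull).
  rewrite mulmxBr Wg mul_mx_scalar -mul_scalar_mx -mulmxBl; congr (\rank (_ *m _)).
  by apply/matrixP => i j; rewrite !mxE; case: eqP => //= _; rewrite ?mulr1n ?mulr0n ?subrr.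
rewrite rank_diag_mx [RHS]cardsCs card_ord; congr (_ - _)%N.
by apply: eq_card => i; rewrite !inE mxE subr_eq0.
Qed.

Lemma commute_diag_mx n (d : 'rV[F]_n) (B : 'M[F]_n) :
    injective (d 0) -> B *m diag_mx d = diag_mx d *m B ->
  B = diag_mx (\row_i B i i).
Proof.
move=> injd /matrixP BD; apply/matrixP => i j; rewrite !mxE.
have := BD i j; rewrite mul_mx_diag mul_diag_mx !mxE => /eqP.
have [-> //|ij] := eqVneq i j; rewrite mulrC -subr_eq0 -mulrBl mulf_eq0 subr_eq0.
by case/orP => [/eqP/injd ji|/eqP ->]; [rewrite ji eqxx in ij|rewrite mulr0n].
Qed.

Lemma horner_mx_conj n (W g : 'M[F]_n.+1) (e : 'rV_n.+1) (p : {poly F}) :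
    W *m g = diag_mx e *m W ->
  W *m horner_mx g p = diag_mx (map_mx (horner p) e) *m W.
Proof.
move=> Wg; rewrite -horner_mx_diag.
elim/poly_ind: p => [|p a IHp]; first by rewrite !rmorph0 mul0mx mulmx0.
rewrite !rmorphD !rmorphM /= !horner_mx_X !horner_mx_C mulmxDl mulmxDr.
rewrite -!mulmxE -mulmxA -Wg !mulmxA IHp; congr (_ + _).
by rewrite mul_scalar_mx mul_mx_scalar.
Qed.

(** The polynomial whose roots are all the eigenvalues but one isolates one
coefficient of a linear relation between the rows. *)
Lemma eigenrows_unit n (g W : 'M[F]_n.+1) (e : 'rV_n.+1) :
    injective (e 0) -> (forall i, row i W != 0) -> W *m g = diag_mx e *m W ->
  W \in unitmx.
Proof.
move=> inje nzW Wg; rewrite -row_free_unit; apply: inj_row_free => z zW.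
apply/matrixP => k i; rewrite ord1 mxE.
pose p := \prod_(j | j != i) ('X - (e 0 j)%:P).
have : z *m (W *m horner_mx g p) = 0 by rewrite mulmxA zW mul0mx.
rewrite (horner_mx_conj _ Wg) mulmxA.
have -> : z *m diag_mx (map_mx (horner p) e) = (z 0 i * p.[e 0 i]) *: delta_mx 0 i.
  apply/matrixP => r j; rewrite ord1 mul_mx_diag !mxE eqxx /=.
  have [->|ji] := eqVneq j i; first by rewrite mulr1.
  by rewrite mulr0n /p horner_prod (bigD1 j) //= hornerXsubC subrr mul0r !mulr0.
rewrite -scalemxAl -rowE => /eqP; rewrite scaler_eq0 (negPf (nzW i)) orbF mulf_eq0.
case/orP => [/eqP //|]; rewrite horner_prod => /eqP pe0; exfalso; move/eqP: pe0.
apply/negP/prodf_neq0 => j ji; rewrite !hornerE subr_eq0.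
by apply: contra_neq ji => /inje.
Qed.

End DiagonalForms.

(** * Real multiplication on the tangent space *)

Section RealMultiplication.

Variables (R : realType) (M : fieldExtType rat) (L : {subfield M}).
Variables (sigma : 'I_6 -> {rmorphism subvs_of L -> R}) (c : subvs_of L).
Hypothesis sigma_c_inj : injective (fun i => sigma i c).
Hypothesis cP : forall x : subvs_of L,
  exists2 p : {poly rat}, (size p <= 6)%N & x = evalq p c.
Hypothesis intc : integralOver intr c.

Local Notation C := R[i].
Local Notation RtoC := (real_complex R).
Local Notation "p ^RC" := (map_poly RtoC p) (at level 2, format "p ^RC").

Definition sigma_row (x : subvs_of L) : 'rV[C]_6 := \row_i RtoC (sigma i x).

Lemma sigma_row_inj : injective (sigma_row c 0).
Proof. by move=> i j; rewrite !mxE => /complexI /sigma_c_inj. Qed.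

Lemma evalq_mx (F : fieldExtType rat) (f : {rmorphism F -> 'M[C]_6}) p x :
  f (evalq p x) = horner_mx (f x) (map_poly ratr p).
Proof.
rewrite rmorph_evalq /horner_mx /horner_morph -map_poly_comp; congr (_.[_]).
by apply: eq_map_poly => q /=; rewrite (fmorph_rat (@scalar_mx _ 6)).
Qed.

(** A rational polynomial that vanishes at [c] has the six distinct reals
[sigma i c] as roots. *)
Lemma evalq_c_eq0 (p : {poly rat}) : (size p <= 6)%N -> evalq p c = 0 -> p = 0.
Proof.
move=> szp pc0; apply/eqP; rewrite -(map_poly_eq0 (ratr : {rmorphism rat -> R})).
apply: contraT => nzp; have := max_poly_roots nzp _ (_ : uniq (codom (fun i => sigma i c))).
rewrite size_codom card_ord size_map_poly ltnNge szp; apply; last exact/injectiveP.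
apply/allP => _ /codomP[i ->].
by rewrite rootE -rmorph_evalq pc0 rmorph0.
Qed.

Lemma minpoly_c : exists2 p : {poly rat}, evalq p c = 0 &
  map_poly ratr p = \prod_i ('X - (sigma i c)%:P).
Proof.
have [p szp cE] := cP (c ^+ 6).
have pc0 : evalq ('X^6 - p) c = 0.
  rewrite /evalq rmorphB /= map_polyXn hornerD hornerN hornerXn -/(evalq p c).
  by rewrite -cE subrr.
exists ('X^6 - p) => //.
have szq : size ('X^6 - p) = 7%N.
  by rewrite size_polyDl ?size_polyN size_polyXn // ltnS.
have := @all_roots_prod_XsubC _ (map_poly ratr ('X^6 - p)) (codom (fun i => sigma i c)).
rewrite size_map_poly szq size_codom card_ord => /(_ (erefl _)) ->.
- rewrite lead_coef_map lead_coefE szq coefB coefXn /= nth_default // subr0 rmorph1.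
  by rewrite scale1r /codom big_image.
- apply/allP => _ /codomP[i ->].
  by rewrite rootE -(rmorph_evalq (sigma i)) pc0 rmorph0.
- by rewrite uniq_rootsE; apply/injectiveP.
Qed.

Section Variety.

Variable A : ppavRM R L.
Local Notation u := (rm A c).

Lemma rm_rational Bm : lattice_basis (lat A) Bm ->
  forall x, exists X, rational_rep Bm (rm A x) X.
Proof.
move=> LB x; have [p _ ->] := cP x.
have [X uX] : exists X, rational_rep Bm u X.
  apply: (End0_rep LB); exists 1%N => //; rewrite mulr1n; exact: rm_integral.
exists (horner_mx X p); rewrite /rational_rep evalq_mx map_horner_mx.
exact: horner_mx_intertwine.
Qed.

Lemma rational_eval y (p : {poly R}) : is_End0 (lat A) y -> (size p <= 6)%N ->
  y = horner_mx u p^RC -> exists x, y = rm A x.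
Proof.
move=> endy szp yE; have [Bm LB] := (is_latticeP _).1 (lat_lattice A).
have [Y yY] := End0_rep LB endy; have [X uX] := rm_rational LB c.
have [q _ ->] := rational_polynomial LB uX yY szp yE.
by exists (evalq q c); rewrite evalq_mx.
Qed.

(** A real annihilator of degree at most 5 would descend to a rational one by
[rational_polynomial], against [evalq_c_eq0]. *)
Lemma no_small_annihilator (p : {poly R}) :
  p \is monic -> (size p <= 6)%N -> horner_mx u p^RC != 0.
Proof.
move=> monp szp; apply: contraT => /negPn/eqP pu0.
have [Bm LB] := (is_latticeP _).1 (lat_lattice A).
have [X uX] := rm_rational LB c; pose k := (size p).-1.
have szk : (k < 6)%N by rewrite /k prednK // lt0n size_poly_eq0 monic_neq0.
have [Y ckY] := rm_rational LB (c ^+ k).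
have [||q szq ckE] := rational_polynomial LB (p := 'X^k - p) (k := k) uX ckY.
- apply/leq_sizeP => j; rewrite leq_eqVlt => /orP[/eqP <-|ltkj].
    by rewrite coefB coefXn eqxx -lead_coefE (monicP monp) subrr.
  rewrite coefB coefXn gtn_eqF // nth_default ?subrr //.
  by move: ltkj; rewrite /k; case: (size p).
- by rewrite !rmorphB /= pu0 subr0 map_polyXn !rmorphXn /= horner_mx_X.
pose r : {poly rat} := 'X^k - q; have /evalq_c_eq0 : (size r <= 6)%N.
  by rewrite (leq_trans (size_polyD _ _)) // geq_max size_polyXn szk size_polyN ltnW ?(leq_trans _ szk).
have -> : evalq r c = 0.
  apply: (fmorph_inj (rm A)); rewrite rmorph0 evalq_mx /r !rmorphB /= -ckE.
  by rewrite map_polyXn !rmorphXn /= horner_mx_X subrr.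
move=> /(_ (erefl _)) /(congr1 (fun r : {poly rat} => r`_k)); rewrite /r.
by rewrite coefB coefXn eqxx coef0 nth_default // subr0 => /eqP; rewrite oner_eq0.
Qed.

(** Each conjugate of [c] is an eigenvalue of [rm A c]: otherwise the product of
the other five linear factors of the minimal polynomial of [c] would annihilate
[rm A c]. *)
Lemma eigenbasis : exists2 W : 'M[C]_6, W \in unitmx &
  forall x, W *m rm A x = diag_mx (sigma_row x) *m W.
Proof.
pose p i := \prod_(j | j != i) ('X - (sigma j c)%:P).
have nzP i : horner_mx u (p i)^RC != 0.
  apply: no_small_annihilator; first exact: monic_prod_XsubC.
  rewrite (_ : p i = \prod_(j <- enum (predC1 i)) ('X - (sigma j c)%:P)); last by rewrite big_enum.
  by rewrite size_prod_XsubC -cardE cardC1 card_ord.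
have eigP i : horner_mx u (p i)^RC *m u = RtoC (sigma i c) *: horner_mx u (p i)^RC.
  have [m mc0 mE] := minpoly_c.
  have : horner_mx u (\prod_i ('X - (sigma i c)%:P))^RC = 0.
    rewrite -mE -map_poly_comp (eq_map_poly (g := ratr)) => [|q]; last exact: fmorph_rat.
    by rewrite -evalq_mx mc0 rmorph0.
  rewrite (bigD1 i) //= mulrC !rmorphM /= -/(p i) map_polyXsubC !rmorphB /=.
  rewrite horner_mx_X horner_mx_C -mulmxE mulmxBr => /eqP; rewrite subr_eq0 => /eqP ->.
  by rewrite mul_mx_scalar.
have rowP i : exists k, row k (horner_mx u (p i)^RC) != 0.
  apply/existsP; apply: contraNT (nzP i); rewrite negb_exists => /forallP r0.
  by apply/eqP/row_matrixP => k; rewrite row0; apply/eqP; rewrite -[_ == 0]negbK.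
have [k kP] := fin_all_exists rowP.
pose W : 'M[C]_6 := \matrix_i row (k i) (horner_mx u (p i)^RC).
have Wu : W *m u = diag_mx (sigma_row c) *m W.
  apply/row_matrixP => i; rewrite row_mul rowK -row_mul eigP linearZ /=.
  by rewrite row_diag_mul mxE rowK.
have Wunit : W \in unitmx.
  by apply: (eigenrows_unit sigma_row_inj _ Wu) => i; rewrite rowK.
exists W => // x; have [q _ ->] := cP x.
rewrite evalq_mx (horner_mx_conj _ Wu); congr (diag_mx _ *m _).
apply/matrixP => r i; rewrite !mxE rmorph_evalq -horner_map -map_poly_comp /=.
by congr (_.[_]); apply: eq_map_poly => a /=; rewrite fmorph_rat.
Qed.

(** The coordinates in a basis of the lattice are rational forms, so commutation
on the rational cohomology is commutation of matrices. *)
Lemma separated_by_H1Q v w :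
  (forall h, is_H1Q A h -> h v = h w) -> v = w.
Proof.
move=> hvw; have [Bm LB] := (is_latticeP _).1 (lat_lattice A).
pose Nu := realify_basis_unit LB.
pose h j (x : 'cV[C]_6) := (invmx (realify Bm) *m realify x) j 0.
have realifyD (x y : 'cV[C]_6) : realify (x + y) = realify x + realify y.
  have [X ->] := basis_span LB x; have [Y ->] := basis_span LB y.
  by rewrite -mulmxDr -map_mxD !realifyM mulmxDr.
have realifyZ r (x : 'cV[C]_6) : realify (RtoC r *: x) = r *: realify x.
  have [X ->] := basis_span LB x; rewrite scalemxAr -map_mxZ !realifyM.
  by rewrite scalemxAr.
have hH j : is_H1Q A (h j).
  split=> [x y|r x|x /LB.2[m ->]].
  - by rewrite /h realifyD mulmxDr mxE.
  - by rewrite /h realifyZ -scalemxAr mxE.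
  - exists (m j 0)%:~R; rewrite ratr_int /h.
    have -> : map_mx (intr : int -> C) m = map_mx RtoC (map_mx intr m).
      by apply/matrixP => a b; rewrite !mxE rmorph_int.
    by rewrite realifyM mulKmx // mxE.
apply: realify_inj; apply: (can_inj (mulKVmx Nu)).
by apply/matrixP => j k; rewrite ord1; exact: (hvw _ (hH j)).
Qed.

End Variety.
End RealMultiplication.

(** * Weil structures in diagonal form *)

Section DiagonalMorphism.

Variables (A : fieldType) (F : fieldType) (f : 'I_6 -> {rmorphism A -> F}).

Definition diag_morph (x : A) : 'M[F]_6 := diag_mx (\row_i f i x).

Fact diag_morph_is_zmod_morphism : zmod_morphism diag_morph.
Proof.
move=> x y; apply/matrixP => i j; rewrite !mxE rmorphB.
by case: eqP => _; rewrite ?mulr1n ?mulr0n ?subrr.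
Qed.

Fact diag_morph_is_monoid_morphism : monoid_morphism diag_morph.
Proof.
split=> [|x y]; first by apply/matrixP => i j; rewrite !mxE rmorph1.
rewrite -mulmxE mulmx_diag; congr diag_mx.
by apply/rowP => i; rewrite !mxE rmorphM.
Qed.

HB.instance Definition _ :=
  GRing.isZmodMorphism.Build A 'M[F]_6 diag_morph diag_morph_is_zmod_morphism.
HB.instance Definition _ :=
  GRing.isMonoidMorphism.Build A 'M[F]_6 diag_morph diag_morph_is_monoid_morphism.

End DiagonalMorphism.

Section WeilStructures.

Variables (R : realType) (d : nat) (M : fieldExtType rat) (K L : {subfield M}).
Variables (s : subvs_of K) (sigma : 'I_6 -> {rmorphism subvs_of L -> R}).
Variable c : subvs_of L.
Hypothesis sigma_c_inj : injective (fun i => sigma i c).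
Hypothesis cP : forall x : subvs_of L,
  exists2 p : {poly rat}, (size p <= 6)%N & x = evalq p c.
Hypothesis intc : integralOver intr c.
Hypothesis d_gt0 : (0 < d)%N.
Hypothesis s_sqr : s ^+ 2 = - d%:R.
Hypothesis sP : forall k : subvs_of K, exists p : {poly rat}, k = evalq p s.

Local Notation C := R[i].
Local Notation RtoC := (real_complex R).

(** The embeddings of [M] are indexed by an embedding of [L] and a sign, the value
[true] standing for the embeddings that send [s] to [isqrt R d]. *)
Definition signed_root (b : bool) : C := if b then isqrt R d else - isqrt R d.

Variable emb : 'I_6 -> bool -> {rmorphism M -> C}.
Hypothesis embL : forall i b (x : subvs_of L), emb i b (vsval x) = RtoC (sigma i x).
Hypothesis embs : forall i b, emb i b (vsval s) = signed_root b.
Hypothesis embP : forall f, exists i b, f = emb i b.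

Lemma isqrt_neq0 : isqrt R d != 0.
Proof. by rewrite eq_complex /= negb_and sqrtr_eq0 -ltNge ltr0n d_gt0 orbT. Qed.

Lemma sqr_isqrt : isqrt R d ^+ 2 = - d%:R.
Proof.
apply/eqP; rewrite -(rmorph_nat RtoC) eq_complex /= !mul0r mulr0 addr0 sub0r oppr0 eqxx.
by rewrite -expr2 sqr_sqrtr ?ler0n ?eqxx.
Qed.

Lemma signed_rootN b : signed_root (~~ b) = - signed_root b.
Proof. by case: b; rewrite /= ?opprK. Qed.

Lemma signed_root_inj : injective signed_root.
Proof.
have pmN : isqrt R d != - isqrt R d.
  by rewrite -subr_eq0 opprK -mulr2n mulrn_eq0 negb_or isqrt_neq0.
by case=> [] [] //= /eqP; rewrite ?(negPf pmN) // eq_sym (negPf pmN).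
Qed.

Lemma sqrt_signed (z : C) : z ^+ 2 = - d%:R -> z = signed_root (z == isqrt R d).
Proof.
rewrite -sqr_isqrt => /eqP; rewrite eqf_sqr /signed_root.
by case: eqP => //= _ /eqP.
Qed.

Lemma emb_inj i b i' b' : emb i b = emb i' b' -> i = i' /\ b = b'.
Proof.
move=> eqe; split; last by apply: signed_root_inj; rewrite -(embs i) eqe embs.
by apply: sigma_c_inj; apply: (@complexI R); rewrite -(embL i b) eqe embL.
Qed.

Lemma emb_evalq i b p : emb i b (vsval (evalq p s)) = (map_poly ratr p).[signed_root b].
Proof.
have /= -> := rmorph_evalq (emb i b \o vsval : {rmorphism subvs_of K -> C}) p s.
by rewrite embs.
Qed.

Lemma emb_ext (f : {rmorphism M -> C}) i b : (forall x : subvs_of L, f (vsval x) = RtoC (sigma i x)) ->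
  f (vsval s) = signed_root b -> f = emb i b.
Proof.
have [j [b' ->]] := embP f; rewrite embs => fL /signed_root_inj <-.
suffices -> : j = i by [].
by apply: sigma_c_inj; apply: (@complexI R); rewrite -(embL j b').
Qed.

Definition emb_row (eps : 'I_6 -> bool) (k : subvs_of K) : 'rV[C]_6 :=
  \row_i emb i (eps i) (vsval k).

(** The rows of [W] are eigenvectors spanning [H^{1,0}(A)]. The signs [eps] carry
all the information on [eta]: they give its sign-assignment and its CM type. *)
Record diagonal_form (A : ppavRM R L) (eta : {rmorphism subvs_of K -> 'M[C]_6})
    (W : 'M[C]_6) (eps : 'I_6 -> bool) : Prop := DiagonalForm {
  df_unit : W \in unitmx;
  df_rm : forall x, W *m rm A x = diag_mx (sigma_row sigma x) *m W;
  df_eta : forall k, W *m eta k = diag_mx (emb_row eps k) *m W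
}.

Lemma mulmx_ext m n (X Y : 'M[C]_(m, n)) : (forall v : 'cV_n, X *m v = Y *m v) -> X = Y.
Proof.
move=> XY; apply/matrixP => i j; have /matrixP/(_ i 0) := XY (delta_mx j 0).
by rewrite -!matrix.colE !mxE.
Qed.

Lemma weil_commute_rm (A : ppavRM R L)
    (eta : {rmorphism subvs_of K -> 'M[C]_6}) k : weil_structure d s A eta ->
  eta k *m rm A c = rm A c *m eta k.
Proof.
move=> wA; apply: mulmx_ext => v; rewrite -!mulmxA.
apply: (@separated_by_H1Q _ _ _ A) => h hH; exact: (weil_commute wA).
Qed.

Lemma diag_conj_eigenbasis (A : ppavRM R L) (W y : 'M[C]_6) : W \in unitmx ->
    (forall x, W *m rm A x = diag_mx (sigma_row sigma x) *m W) ->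
    y *m rm A c = rm A c *m y ->
  exists e, W *m y = diag_mx e *m W.
Proof.
move=> Wu Wrm yc; exists (\row_i (W *m y *m invmx W) i i).
rewrite -(commute_diag_mx (sigma_row_inj sigma_c_inj)) ?mulmxKV //.
apply: (can_inj (mulmxK Wu)); rewrite -[LHS]mulmxA -Wrm [LHS]mulmxA mulmxKV //.
by rewrite -[RHS]mulmxA mulmxKV // [RHS]mulmxA -Wrm -!mulmxA yc.
Qed.

(** Since the characters of [L] on [H^{1,0}(A)] are distinct, [eta] preserves each
eigenline of [L]; it acts there through one of the two embeddings of [K]. *)
Lemma diagonal_form_on (A : ppavRM R L) (eta : {rmorphism subvs_of K -> 'M[C]_6}) W :
    W \in unitmx -> (forall x, W *m rm A x = diag_mx (sigma_row sigma x) *m W) ->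
    weil_structure d s A eta ->
  exists eps, diagonal_form A eta W eps /\ #|[set i | eps i]%SET| = 3%N.
Proof.
move=> Wu Wrm wA.
have [e We] := diag_conj_eigenbasis Wu Wrm (weil_commute_rm s wA).
have e2 i : e 0 i ^+ 2 = - d%:R.
  have : W *m (eta s *m eta s) = - d%:R *: W.
    rewrite -mul_mx_scalar; congr (_ *m _).
    rewrite mulmxE -expr2 -rmorphXn s_sqr rmorphN rmorph_nat.
    by rewrite [RHS]rmorphN rmorph_nat.
  rewrite mulmxA We -mulmxA We mulmxA mulmx_diag.
  move/(congr1 (fun Z => (Z *m invmx W) i i)).
  by rewrite mulmxK // -scalemxAl mulmxV // !mxE eqxx mulr1n mulr1 expr2.
pose eps i := e 0 i == isqrt R d.
have eE : e = \row_i signed_root (eps i).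
  by apply/rowP => i; rewrite mxE; apply: sqrt_signed.
exists eps; split.
  split=> // k; have [p ->] := sP k.
  rewrite evalq_mx (horner_mx_conj _ We) eE; congr (diag_mx _ *m _).
  by apply/rowP => i; rewrite !mxE emb_evalq.
apply: etrans (weil_eigen_pos wA); rewrite (rank_eigenspace_diag _ Wu We).
by apply: eq_card => i; rewrite !inE.
Qed.

Lemma weil_diagonal_form (A : ppavRM R L) (eta : {rmorphism subvs_of K -> 'M[C]_6}) :
    weil_structure d s A eta ->
  exists W eps, diagonal_form A eta W eps /\ #|[set i | eps i]%SET| = 3%N.
Proof.
move=> wA; have [W Wu Wrm] := eigenbasis sigma_c_inj cP intc A.
by have [eps] := diagonal_form_on Wu Wrm wA; exists W, eps.
Qed.

Section DiagonalFormTheory.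

Variables (A : ppavRM R L) (eta : {rmorphism subvs_of K -> 'M[C]_6}).
Variables (W : 'M[C]_6) (eps : 'I_6 -> bool).
Hypothesis df : diagonal_form A eta W eps.

Lemma row_df_neq0 i : row i W != 0.
Proof.
have := df_unit df; rewrite -row_free_unit => /row_free_inj Winj.
rewrite rowE -[X in _ != X](mul0mx _ W); apply/eqP => /Winj/matrixP/(_ 0 i).
by rewrite !mxE !eqxx => /eqP; rewrite oner_eq0.
Qed.

Lemma row_df_rm i x : row i W *m rm A x = RtoC (sigma i x) *: row i W.
Proof. by rewrite -row_mul (df_rm df) row_diag_mul mxE. Qed.

Lemma row_df_eta i k : row i W *m eta k = emb i (eps i) (vsval k) *: row i W.
Proof. by rewrite -row_mul (df_eta df) row_diag_mul mxE. Qed.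

Lemma H10_df (w : 'rV[C]_6) i : w *m rm A c = RtoC (sigma i c) *: w ->
  exists a, w = a *: row i W.
Proof.
pose z := w *m invmx W; have wE : w = z *m W by rewrite mulmxKV // (df_unit df).
rewrite {1 2}wE => weig; exists (z 0 i); rewrite rowE scalemxAl wE; congr (_ *m _).
have : z *m diag_mx (sigma_row sigma c) = RtoC (sigma i c) *: z.
  apply: (can_inj (mulmxK (df_unit df))).
  by rewrite -mulmxA -(df_rm df) mulmxA weig scalemxAl.
move=> zE; apply/rowP => j; have /rowP/(_ j) := zE; rewrite mul_mx_diag !mxE eqxx /=.
have [->|ji /eqP] := eqVneq j i; first by rewrite mulr1.
rewrite mulrC -subr_eq0 -mulrBl mulf_eq0 subr_eq0 mulr0.
by case/orP => /eqP // /complexI/sigma_c_inj ji'; rewrite ji' eqxx in ji.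
Qed.

Lemma has_signs_df I : sign_assignment I ->
  has_signs d s sigma I A eta <-> I.1 = [set i | eps i]%SET.
Proof.
move=> [I2 _ _]; split=> [[pos neg]|I1E].
  have eps_of b i : row i W *m eta s = signed_root b *: row i W -> eps i = b.
    rewrite row_df_eta embs => /eqP; rewrite -subr_eq0 -scalerBl scaler_eq0.
    by rewrite (negPf (row_df_neq0 i)) orbF subr_eq0 => /eqP/signed_root_inj.
  have H10 i : is_H10 A (sigma i) (row i W) by move=> x; exact: row_df_rm.
  apply/setP => i; rewrite inE; have [Ii|nIi] := boolP (i \in I.1).
    by rewrite (eps_of true) // (pos _ _ Ii (H10 i)).
  by rewrite (eps_of false) // (neg i) // I2 inE.
have H10 i w : is_H10 A (sigma i) w -> w *m eta s = signed_root (eps i) *: w.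
  move=> /(_ c)/H10_df[a ->].
  by rewrite -scalemxAl row_df_eta embs !scalerA mulrC.
split=> i w; rewrite ?I2 I1E ?inE => ei /H10 ->; first by rewrite ei.
by rewrite (negPf ei).
Qed.

Lemma CM_type_of_df :
  CM_type_of (A, eta) = [set emb i (eps i) | i in [set: 'I_6]].
Proof.
apply/seteqP; split=> [f [w nzw [wrm weta]]|_ [i _ <-]]; last first.
  exists (row i W); first exact: row_df_neq0.
  by split=> [x|k]; rewrite /= ?row_df_rm ?row_df_eta ?embL.
have [i [b fE]] := embP f; exists i => //; rewrite fE; congr (emb i _).
have [a wE] : exists a, w = a *: row i W by apply: H10_df; rewrite wrm fE embL.
apply: signed_root_inj; have := weta s; rewrite {1}wE -scalemxAl row_df_eta.
rewrite !scalerA mulrC -scalerA -wE embs fE embs => /eqP.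
by rewrite -subr_eq0 -scalerBl scaler_eq0 (negPf nzw) orbF subr_eq0 => /eqP.
Qed.

End DiagonalFormTheory.

(** * CM types as sets of embeddings of the real field *)

Definition CM_type_set (S : {set 'I_6}) : set {rmorphism M -> C} :=
  [set emb i (i \in S) | i in [set: 'I_6]].

Lemma CM_type_set_mem S i b : CM_type_set S (emb i b) <-> (i \in S) = b.
Proof.
split=> [[j _ /emb_inj[-> ->]] //|<-].
by exists i.
Qed.

Lemma CM_type_set_inj : injective CM_type_set.
Proof.
move=> S T ST; apply/setP => i; apply/esym.
by apply/(CM_type_set_mem T i); rewrite -ST; apply/CM_type_set_mem.
Qed.

Lemma is_phi_emb i b f : is_phi s sigma i (signed_root b) f <-> f = emb i b.
Proof.
split=> [[fL fs]|->]; first exact: emb_ext.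
by split=> [x|]; rewrite ?embL ?embs.
Qed.

Lemma CM_type_of_signsE I : sign_assignment I ->
  CM_type_of_signs d s sigma I = CM_type_set I.1.
Proof.
move=> [I2 _ _]; apply/seteqP; split=> [f [[i Ii /(is_phi_emb i true) ->]|
    [i Ii /(is_phi_emb i false) ->]]|_ [i _ <-]].
- exact/CM_type_set_mem.
- by apply/CM_type_set_mem; move: Ii; rewrite I2 inE => /negPf.
- case: (boolP (i \in I.1)) => Ii; [left|right]; exists i; rewrite ?I2 ?inE //.
Qed.

Lemma sign_assignment_ext I J : sign_assignment I -> sign_assignment J ->
  I.1 = J.1 -> I = J.
Proof. by case: I J => [I1 I2] [J1 J2] [/= -> _ _] [/= -> _ _] ->. Qed.

Lemma sign_assignmentP (S : {set 'I_6}) : #|S| = 3%N -> sign_assignment (S, ~: S).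
Proof.
by move=> S3; split=> //=; rewrite cardsCs finset.setCK S3 card_ord.
Qed.

Lemma weil_signs (A : ppavRM R L) (eta : {rmorphism subvs_of K -> 'M[C]_6}) : weil_structure d s A eta ->
  exists2 I, sign_assignment I &
    has_signs d s sigma I A eta /\ CM_type_of (A, eta) = CM_type_of_signs d s sigma I.
Proof.
move=> /weil_diagonal_form[W [eps [df card_eps]]].
have Isign := sign_assignmentP card_eps; exists ([set i | eps i]%SET, ~: [set i | eps i]%SET) => //.
split; first exact/(has_signs_df df).
rewrite (CM_type_of_df df) CM_type_of_signsE //.
by apply: eq_imagel => i _ /=; rewrite inE.
Qed.

Lemma CM_type_of_signs_inj I J : sign_assignment I -> sign_assignment J ->
  CM_type_of_signs d s sigma I = CM_type_of_signs d s sigma J -> I = J.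
Proof.
move=> sI sJ; rewrite !CM_type_of_signsE // => /CM_type_set_inj.
exact: sign_assignment_ext.
Qed.

Lemma has_signs_CM_type (A : ppavRM R L)
    (eta : {rmorphism subvs_of K -> 'M[C]_6}) I :
    weil_structure d s A eta -> sign_assignment I ->
  has_signs d s sigma I A eta <-> CM_type_of (A, eta) = CM_type_of_signs d s sigma I.
Proof.
move=> wA sI; have [J sJ [sgnJ ->]] := weil_signs wA.
have [W [eps [df _]]] := weil_diagonal_form wA; split=> [|/CM_type_of_signs_inj <- //].
move/(has_signs_df df sI); rewrite -((has_signs_df df sJ).1 sgnJ) => IJ.
by rewrite (sign_assignment_ext sI sJ).
Qed.

Definition conj_emb (f : {rmorphism M -> C}) : {rmorphism M -> C} := (@conjc R) \o f.

Lemma conj_embE i b : conj_emb (emb i b) = emb i (~~ b).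
Proof.
apply: emb_ext => [x|]; first by rewrite /= embL; exact: conjc_real.
rewrite /= embs signed_rootN; apply/eqP.
by case: b; rewrite /signed_root eq_complex /= ?oppr0 !eqxx.
Qed.

Lemma conj_CM_type_set S : conj_type (CM_type_set S) = CM_type_set (~: S).
Proof.
apply/seteqP; split=> [_ [_ [i _ <-] <-]|_ [i _ <-]].
  rewrite -[X in CM_type_set _ X]/(conj_emb (emb i (i \in S))) conj_embE.
  by apply/CM_type_set_mem; rewrite inE.
exists (emb i (i \in S)); first exact/CM_type_set_mem.
by rewrite -[LHS]/(conj_emb (emb i (i \in S))) conj_embE inE.
Qed.

Lemma CM_typeP Phi : CM_type Phi <-> exists S, Phi = CM_type_set S.
Proof.
split=> [[_ disj full]|[S ->]].
  have PhiN i : Phi (emb i true) -> Phi (emb i false) -> False.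
    move=> Pt Pf; suff : (Phi `&` conj_type Phi) (emb i true) by rewrite disj.
    split=> //; exists (emb i false) => //.
    by rewrite -[LHS]/(conj_emb (emb i false)) conj_embE.
  have PhiU i : ~ Phi (emb i true) -> Phi (emb i false).
    move=> nPt; have : (Phi `|` conj_type Phi) (emb i true) by rewrite full.
    case=> // -[f Pf]; rewrite -[LHS]/(conj_emb f) => fE.
    have [j [b fjb]] := embP f; move: fE; rewrite fjb conj_embE => /emb_inj[ji].
    by rewrite -ji; case: b fjb => // <-.
  exists [set i | `[< Phi (emb i true) >]]%SET; apply/seteqP; split=> f; last first.
    move=> [i _ <-]; rewrite inE; case: asboolP => //; exact: PhiU.
  have [i [b ->]] := embP f => Pf; apply/CM_type_set_mem; rewrite inE.
  by case: b Pf => [|Pf]; [exact: asboolT|apply: asboolF => /PhiN; apply].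
split; last 1 first.
- rewrite conj_CM_type_set; apply/seteqP; split=> // f _.
  have [i [b ->]] := embP f.
  have [iS|iS] := eqVneq (i \in S) b; [left|right]; apply/CM_type_set_mem => //.
  by rewrite inE; move: iS; case: (i \in S) b => [] [].
- have /card_imset_inj : {in [set: 'I_6]%SET &, injective (fun i => emb i (i \in S))}.
    by move=> i j _ _ /emb_inj[].
  rewrite cardsT card_ord; apply: card_eq_trans.
  by rewrite (_ : [set` _] = setT) //; apply/seteqP; split=> // i _; rewrite /= inE.
- rewrite conj_CM_type_set; apply/seteqP; split=> // f [].
  have [i [b ->]] := embP f => /CM_type_set_mem <- /CM_type_set_mem.
  by rewrite inE; case: (i \in S).
Qed.

Lemma CM_type_set_plus S :
  CM_type_set S `&` [set f | exists i, is_phi s sigma i (isqrt R d) f] =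
  [set emb i true | i in [set` S]].
Proof.
apply/seteqP; split=> [f [[i _ <-] [j]]|_ [i Si <-]].
  move/(is_phi_emb j true) => /emb_inj[_ iS]; exists i; rewrite /= ?iS //.
split; first by apply/CM_type_set_mem.
by exists i; apply/(is_phi_emb i true).
Qed.

Lemma weil_compatible_set S :
  weil_compatible d s sigma (CM_type_set S) <-> #|S| = 3%N.
Proof.
have card_plus : ([set emb i true | i in [set` S]] #= `I_#|S|)%card.
  by apply: card_imset_inj => i j _ _ /emb_inj[].
rewrite /weil_compatible CM_type_set_plus; split=> [[_ card3]|S3].
  by apply/card_eq_II; rewrite -(card_eql card_plus).
split; first by apply/CM_typeP; exists S.
by rewrite S3 in card_plus.
Qed.

Lemma weil_compatibleP Phi : weil_compatible d s sigma Phi <->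
  exists2 S : {set 'I_6}, #|S| = 3%N & Phi = CM_type_set S.
Proof.
split=> [wPhi|[S S3 ->]]; last exact/weil_compatible_set.
have [S PhiE] := (CM_typeP Phi).1 wPhi.1; exists S => //.
by apply/weil_compatible_set; rewrite -PhiE.
Qed.

Lemma CM_type_neq_conj (Phi : set {rmorphism M -> C}) : CM_type Phi -> Phi <> conj_type Phi.
Proof.
move=> /CM_typeP[S ->]; rewrite conj_CM_type_set => /CM_type_set_inj/setP/(_ ord0).
by rewrite inE; case: (_ \in S).
Qed.

(** A class of CM types that is stable under complex conjugation splits into
pairs, and each pair has exactly one member containing [emb ord0 true]. *)
Lemma card_CM_types (P : pred {set 'I_6}) (T : set (set {rmorphism M -> C})) n :
    (forall S, P (~: S) = P S) -> T = [set CM_type_set S | S in [set` P]] ->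
    #|[set S | P S]%SET| = n.*2 ->
  (T #= `I_n.*2)%card /\ ([set [set Phi; conj_type Phi] | Phi in T] #= `I_n)%card.
Proof.
move=> PC -> card_P; split.
  have : {in [set S | P S]%SET &, injective CM_type_set} by move=> S S' _ _ /CM_type_set_inj.
  move/card_imset_inj; rewrite card_P; apply: card_eq_trans.
  rewrite (_ : [set` _] = [set` P]) //; apply/seteqP; split=> S; rewrite /= !inE //.
rewrite image_comp.
pose Q := [set S : {set 'I_6} | P S & ord0 \in S]%SET.
have cardQ : #|Q| = n.
  by apply/double_inj; rewrite -card_P (card_half_complement ord0 PC).
have : {in Q &, injective (fun S => [set CM_type_set S; conj_type (CM_type_set S)])}.
  move=> S S'; rewrite !inE => /andP[_ S0] /andP[_ S0'] SS'.
  have : [set CM_type_set S'; conj_type (CM_type_set S')] (CM_type_set S).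
    by rewrite -SS'; left.
  case=> [/CM_type_set_inj //|]; rewrite conj_CM_type_set => /CM_type_set_inj SE.
  by move: S0; rewrite SE inE S0'.
move/card_imset_inj; rewrite cardQ; apply: card_eq_trans.
set X := (X in (X #= _)%card); set Y := (Y in (_ #= Y)%card).
suff -> : X = Y by exact: card_eqxx.
apply/seteqP; split=> _ [S PS <-]; last first.
  by exists S => //; move: PS; rewrite /= !inE => /andP[].
have {}PS : P S := PS.
have [S0|S0] := boolP (ord0 \in S); first by exists S => //; rewrite /= inE PS S0.
exists (~: S); first by rewrite /= !inE PC PS S0.
by rewrite /= !conj_CM_type_set finset.setCK setUC.
Qed.

(** * Two Weil structures on the same variety *)

Lemma CM_type_of_iso (p q : ppavRMK R K L) g : is_iso p.1 q.1 g ->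
  (forall k, g *m p.2 k = q.2 k *m g) -> CM_type_of p = CM_type_of q.
Proof.
move=> [gu _ _ grm] geta.
have ginj (w : 'rV[C]_6) h : h \in unitmx -> w != 0 -> w *m h != 0.
  move=> hu; apply: contra_neq => wh0.
  by rewrite -[w](mulmxK hu) wh0 mul0mx.
apply/seteqP; split=> f [w nzw [wrm weta]].
  exists (w *m invmx g); first by rewrite ginj ?unitmx_inv.
  split=> x; apply: (can_inj (mulmxK gu)); rewrite -scalemxAl mulmxKV // -!mulmxA.
    by rewrite -grm mulKmx.
  by rewrite -geta mulKmx.
exists (w *m g); first exact: ginj.
by split=> x; rewrite -mulmxA ?grm ?geta mulmxA ?wrm ?weta scalemxAl.
Qed.

Lemma interpolation (t : 'I_6 -> R) :
  exists2 p : {poly R}, (size p <= 6)%N & forall i, p.[sigma i c] = t i.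
Proof.
pose a := invmx (conjugates sigma (power_family c)) *m \col_i t i.
exists (\poly_(k < 6) a (inord k) 0); first exact: size_poly.
move=> i; have : (conjugates sigma (power_family c) *m a) i 0 = t i.
  by rewrite mulKVmx ?mxE // (conjugates_powers_unit sigma_c_inj).
move=> <-; rewrite horner_poly mxE; apply: eq_bigr => k _.
by rewrite [conjugates _ _ _ _]mxE rmorphXn inord_val mulrC.
Qed.

Lemma End0_mul (A : ppavRM R L) u v :
  is_End0 (lat A) u -> is_End0 (lat A) v -> is_End0 (lat A) (u *m v).
Proof.
move=> [m m_gt0 um] [n n_gt0 vn]; exists (m * n)%N; first by rewrite muln_gt0 m_gt0.
move=> x Lx; have -> : (u *m v) *+ (m * n) = (u *+ m) *m (v *+ n).
  by rewrite !mulmxE mulrnAr mulrnAl mulrnA.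
by rewrite -mulmxA; apply/um/vn.
Qed.

Lemma End0_conj (A B : ppavRM R L) g u : is_iso A B g ->
  is_End0 (lat B) u -> is_End0 (lat A) (invmx g *m u *m g).
Proof.
move=> [gu glat _ _] [n n_gt0 un]; exists n => // x Lx; apply/glat.
have -> : g *m ((invmx g *m u *m g) *+ n *m x) = (u *+ n) *m (g *m x).
  have -> : (invmx g *m u *m g) *+ n = invmx g *m (u *+ n) *m g.
    by rewrite !mulmxE mulrnAr mulrnAl.
  by rewrite !mulmxA mulmxV // mul1mx -mulmxA.
by apply/un/glat.
Qed.

(** The product of the actions of [s] under two Weil structures on the same
variety is diagonal with eigenvalues [d] and [- d], so it is a real polynomial in
[rm A c]. Being rational on the lattice, it is the action of an element of [L].
One of the conjugates of this element is rational, so all of them are equal. *)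
Lemma weil_signs_unique (A B : ppavRM R L) eta eta' g W eps :
    is_iso A B g -> weil_structure d s A eta -> weil_structure d s B eta' ->
    diagonal_form A eta W eps ->
  exists b, exists2 W', W' \in unitmx & diagonal_form B eta' W' (fun i => b (+) eps i).
Proof.
move=> isog wA wB df; have [gu _ _ grm] := isog.
pose W' := W *m invmx g.
have W'u : W' \in unitmx by rewrite unitmx_mul unitmx_inv gu (df_unit df).
have W'rm x : W' *m rm B x = diag_mx (sigma_row sigma x) *m W'.
  apply: (can_inj (mulmxK gu)); rewrite -mulmxA -grm mulmxA mulmxKV //.
  by rewrite (df_rm df) -mulmxA mulmxKV.
have [eps' [df' _]] := diagonal_form_on W'u W'rm wB.
pose y := eta s *m (invmx g *m eta' s *m g).
pose t i : R := if eps i == eps' i then - d%:R else d%:R.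
have Wy : W *m y = diag_mx (\row_i RtoC (t i)) *m W.
  have -> : W *m y = diag_mx (emb_row eps s) *m (W' *m eta' s *m g).
    by rewrite /y !mulmxA (df_eta df).
  have W'g : W' *m g = W by rewrite mulmxKV.
  rewrite (df_eta df') -(mulmxA _ W') W'g mulmxA mulmx_diag; congr (diag_mx _ *m _).
  apply/rowP => i; rewrite !mxE !embs /t.
  have [<-|] := eqVneq (eps i) (eps' i).
    rewrite rmorphN rmorph_nat -sqr_isqrt -expr2 /signed_root.
    by case: (eps i); rewrite ?sqrrN.
  case: (eps i) (eps' i) => [] [] // _; rewrite /signed_root ?mulrN ?mulNr -expr2.
    by rewrite sqr_isqrt opprK rmorph_nat.
  by rewrite sqr_isqrt opprK rmorph_nat.
have [p szp pt] := interpolation t.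
have yE : y = horner_mx (rm A c) (map_poly RtoC p).
  apply: (can_inj (mulKmx (df_unit df))); rewrite Wy (horner_mx_conj _ (df_rm df c)).
  congr (diag_mx _ *m _); apply/rowP => i; rewrite !mxE.
  by rewrite -pt horner_map.
have endy : is_End0 (lat A) y.
  apply: End0_mul; first exact: (weil_End0 wA).
  by apply: (End0_conj isog); exact: (weil_End0 wB).
have [x yx] := rational_eval cP intc endy szp yE.
have sx i : sigma i x = t i.
  apply: (@complexI R); have := df_rm df x; rewrite -yx Wy.
  move/(can_inj (mulmxK (df_unit df)))/matrixP/(_ i i).
  by rewrite !mxE eqxx !mulr1n => ->.
(* [sigma ord0] is injective, so [x] is the integer [t ord0]. *)
have tE i : t i = t ord0.
  have [q xq] : exists q : int, t ord0 = q%:~R.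
    by rewrite /t; case: ifP => _; [exists (- d%:Z)|exists d%:Z]; rewrite ?rmorphN.
  rewrite -sx (_ : x = q%:~R) ?rmorph_int -?xq //.
  by apply: (fmorph_inj (sigma ord0)); rewrite sx xq rmorph_int.
have ndE : (d%:R == - d%:R :> R) = false.
  by apply/negbTE; rewrite -subr_eq0 opprK -mulr2n mulrn_eq0 pnatr_eq0 -lt0n d_gt0.
exists (eps ord0 (+) eps' ord0), W' => //.
suff -> : (fun i => eps ord0 (+) eps' ord0 (+) eps i) = eps' by [].
apply/funext => i; have := tE i; rewrite /t.
by case: (eps i) (eps' i) (eps ord0) (eps' ord0) => [] [] [] [] //= /eqP; rewrite ?ndE // eq_sym ndE.
Qed.

(** * Abelian varieties of Weil type with prescribed signs *)

Section Construction.

Variable eps : 'I_6 -> bool.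
Variables (e : 'I_6 -> subvs_of L) (rho : subvs_of L).
Hypothesis eu : conjugates sigma e \in unitmx.
Hypothesis eZ : forall x : subvs_of L, integralOver intr x ->
  exists m : 'I_6 -> int, x = \sum_j e j *~ m j.
Hypothesis inte : forall j, integralOver intr (e j).
Hypothesis rhoP : forall i, 0 < (-1) ^+ (~~ eps i) * sigma i rho.

Local Notation "A ^RC" := (map_mx RtoC A) (at level 2, format "A ^RC").
Local Notation "A ^Q" := (map_mx (ratr : rat -> R) A) (at level 2, format "A ^Q").
Local Notation B := (conjugates sigma e).

(** The abelian variety of the point [tau] of [H^6] has the lattice
[tau O_L + O_L^dual], the dual being taken for the trace form, so that the
standard symplectic form is principal. The signs of [rho] put [tau = eta(s) rho]
in the upper half-planes, and [eta(s)] preserves [L + tau L] because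
[eta(s) tau = - d rho]. *)
Definition im_tau (i : 'I_6) : R := Num.sqrt d%:R * ((-1) ^+ (~~ eps i) * sigma i rho).
Definition tau (i : 'I_6) : C := signed_root (eps i) * RtoC (sigma i rho).
Definition period_mx : 'M[C]_(6, 12) :=
  row_mx (diag_mx (\row_i tau i) *m B^RC) ((invmx B)^T)^RC.
Definition weil_lattice : set 'cV[C]_6 :=
  [set v | exists m : 'cV[int]_12, v = period_mx *m map_mx intr m].
Definition weil_form (u v : 'cV[C]_6) : R :=
  \sum_i (complex.Im (u i 0) * complex.Re (v i 0) -
          complex.Re (u i 0) * complex.Im (v i 0)) / im_tau i.

Lemma im_tau_gt0 i : 0 < im_tau i.
Proof. by rewrite mulr_gt0 // sqrtr_gt0 ltr0n. Qed.

Lemma im_tau_neq0 i : im_tau i != 0.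
Proof. by rewrite gt_eqF // im_tau_gt0. Qed.

Lemma tauE i : tau i = (0 +i* im_tau i)%C.
Proof.
apply/eqP; rewrite eq_complex /tau /im_tau /signed_root.
by case: (eps i); rewrite /= !(mulr0, mul0r, oppr0, subr0, addr0, add0r, expr0,
  expr1, mul1r, mulN1r, mulrN, mulNr) !eqxx.
Qed.

Definition tau_coords (r : 'cV[R]_12) : 'cV[R]_6 := @usubmx R 6 6 1 r.
Definition dual_coords (r : 'cV[R]_12) : 'cV[R]_6 := @dsubmx R 6 6 1 r.

Lemma period_mxE (r : 'cV[R]_12) i :
  (period_mx *m r^RC) i 0 =
  (((invmx B)^T *m dual_coords r) i 0 +i* (im_tau i * (B *m tau_coords r) i 0))%C.
Proof.
have -> : period_mx *m r^RC = diag_mx (\row_i tau i) *m (B *m tau_coords r)^RC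
    + ((invmx B)^T *m dual_coords r)^RC.
  rewrite -[r in LHS](@vsubmxK R 6 6 1) (@map_col_mx _ _ _ 6 6 1).
  by rewrite /period_mx (@mul_row_col _ 6 6 6 1) -mulmxA -!map_mxM.
rewrite mxE mul_diag_mx !mxE tauE; apply/eqP.
rewrite eq_complex /= !(mul0r, mulr0, subr0, addr0, add0r).
by rewrite oppr0 add0r !eqxx.
Qed.

Lemma weil_lattice_basis : lattice_basis weil_lattice period_mx.
Proof.
split=> // r r0.
have pE i : (period_mx *m r^RC) i 0 = 0 by rewrite r0 mxE.
have r1 : tau_coords r = 0.
  apply: (can_inj (mulKmx eu)); rewrite mulmx0; apply/colP => i.
  have := pE i; rewrite period_mxE => -[_ /eqP].
  by rewrite mulf_eq0 (negPf (im_tau_neq0 i)) => /eqP ->; rewrite mxE.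
have r2 : dual_coords r = 0.
  have Bu : (invmx B)^T \in unitmx by rewrite unitmx_tr unitmx_inv.
  apply: (can_inj (mulKmx Bu)); rewrite mulmx0; apply/colP => i.
  by have := pE i; rewrite period_mxE => -[-> _]; rewrite mxE.
rewrite -[r](@vsubmxK R 6 6 1) -/(tau_coords r) -/(dual_coords r) r1 r2.
by rewrite col_mx0.
Qed.

Lemma weil_form_periods (r r' : 'cV[R]_12) :
  weil_form (period_mx *m r^RC) (period_mx *m r'^RC) =
  \sum_i (tau_coords r i 0 * dual_coords r' i 0 - dual_coords r i 0 * tau_coords r' i 0).
Proof.
pose x := B *m tau_coords r; pose y := (invmx B)^T *m dual_coords r.
pose x' := B *m tau_coords r'; pose y' := (invmx B)^T *m dual_coords r'.
have dot (a b : 'cV[R]_6) : \sum_i (B *m a) i 0 * ((invmx B)^T *m b) i 0 =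
    \sum_i a i 0 * b i 0.
  have dotE (u v : 'cV[R]_6) : \sum_i u i 0 * v i 0 = (u^T *m v) 0 0.
    by rewrite mxE; apply: eq_bigr => i _; rewrite mxE.
  by rewrite !dotE trmx_mul -mulmxA (mulmxA B^T) -trmx_mul mulVmx // trmx1 mul1mx.
transitivity (\sum_i (x i 0 * y' i 0 - y i 0 * x' i 0)).
  apply: eq_bigr => i _; rewrite !period_mxE /= -/x -/y -/x' -/y'.
  by field; exact: im_tau_neq0.
rewrite !sumrB dot; congr (_ - _).
under eq_bigr do rewrite mulrC.
by rewrite dot; apply: eq_bigr => i _; rewrite mulrC.
Qed.

Lemma int_mx m n (Z : 'M[int]_(m, n)) :
  map_mx (intr : int -> C) Z = (map_mx intr Z)^RC.
Proof. by apply/matrixP => i j; rewrite !mxE rmorph_int. Qed.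

Lemma weil_form_principal : principal_polarization weil_lattice weil_form.
Proof.
split.
- move=> u v w; rewrite -big_split; apply: eq_bigr => i _ /=.
  by rewrite !mxE ReD ImD; ring.
- move=> r u w; rewrite mulr_sumr; apply: eq_bigr => i _.
  by rewrite !mxE [RtoC r * _]mulrC ReMr ImMr; ring.
- move=> u v; rewrite -sumrN; apply: eq_bigr => i _; ring.
- move=> u v; apply: eq_bigr => i _; rewrite !mxE.
  by case: (u i 0) (v i 0) => [a b] [a' b'] /=; ring.
- move=> u nzu.
  have posE : weil_form ('i%C *: u) u = \sum_i
      (complex.Im (u i 0) ^+ 2 + complex.Re (u i 0) ^+ 2) / im_tau i.
    apply: eq_bigr => j _; rewrite !mxE.
    by case: (u j 0) => [a b] /=; ring.
  have sq_ge0 i : 0 <= (complex.Im (u i 0) ^+ 2 + complex.Re (u i 0) ^+ 2) / im_tau i.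
    by rewrite divr_ge0 ?addr_ge0 ?sqr_ge0 // ltW // im_tau_gt0.
  rewrite posE lt_neqAle sumr_ge0 // andbT eq_sym psumr_neq0 //.
  have [i /= ui] : exists i, u i 0 != 0.
    apply/existsP; apply: contraNT nzu; rewrite negb_exists => /forallP u0.
    by apply/eqP/colP => i; rewrite mxE; apply/eqP; rewrite -[_ == _]negbK.
  apply/hasP; exists i; first exact: mem_index_enum.
  rewrite divr_gt0 ?im_tau_gt0 // lt_neqAle addr_ge0 ?sqr_ge0 // andbT eq_sym.
  rewrite paddr_eq0 ?sqr_ge0 // !sqrf_eq0; apply: contra ui.
  by case: (u i 0) => a b /= /andP[/eqP -> /eqP ->].
- move=> u v [m ->] [n ->]; rewrite !int_mx weil_form_periods rpred_sum // => i _.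
  by rewrite rpredB // rpredM // !mxE intr_int.
- move=> u Eu; have [r uE] := basis_span weil_lattice_basis u.
  suffices rint j : r j 0 \is a Num.int.
    exists (\col_j Num.floor (r j 0)); rewrite uE int_mx; congr (_ *m _^RC).
    by apply/colP => j; rewrite !mxE floorK.
  pose dl (j : 'I_12) : 'cV[int]_12 := delta_mx j 0.
  have Eint l : weil_form u (period_mx *m map_mx intr (dl l)) \is a Num.int.
    by apply: Eu; exists (dl l).
  have dlE l i : (map_mx intr (dl l) : 'cV[R]_12) i 0 = (i == l)%:R.
    by rewrite !mxE eqxx andbT; case: (_ == _).
  have part1E (x : 'cV[R]_12) k : tau_coords x k 0 = x (@lshift 6 6 k) 0 by rewrite mxE.
  have part2E (x : 'cV[R]_12) k : dual_coords x k 0 = x (@rshift 6 6 k) 0 by rewrite mxE.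
  have eqll (i k : 'I_6) : ((@lshift 6 6 i : 'I_12) == @lshift 6 6 k) = (i == k) by [].
  have eqrr (i k : 'I_6) : ((@rshift 6 6 i : 'I_12) == @rshift 6 6 k) = (i == k).
    by rewrite -!val_eqE /= eqn_add2l.
  have eqlr (i k : 'I_6) : ((@lshift 6 6 i : 'I_12) == @rshift 6 6 k) = false.
    by rewrite -val_eqE /= ltn_eqF // ltn_addr.
  have eqrl (i k : 'I_6) : ((@rshift 6 6 i : 'I_12) == @lshift 6 6 k) = false.
    by rewrite eq_sym eqlr.
  rewrite -[j](@splitK 6 6); case: (@fintype.split 6 6 j) => k /=.
    have := Eint (@rshift 6 6 k); rewrite uE int_mx weil_form_periods.
    rewrite (bigD1 k) //= big1 => [|i ik].
      by rewrite !part1E !part2E !dlE eqrr eqlr eqxx mulr0 subr0 addr0 mulr1.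
    by rewrite !part1E !part2E !dlE eqrr eqlr (negPf ik) !mulr0 subrr.
  have := Eint (@lshift 6 6 k); rewrite uE int_mx weil_form_periods.
  rewrite (bigD1 k) //= big1 => [|i ik].
    by rewrite !part1E !part2E !dlE eqll eqrl eqxx mulr0 sub0r addr0 mulr1 rpredN.
  by rewrite !part1E !part2E !dlE eqll eqrl (negPf ik) !mulr0 subrr.
Qed.

Definition weil_rm : {rmorphism subvs_of L -> 'M[C]_6} :=
  diag_morph (fun i => RtoC \o sigma i).
Definition weil_eta : {rmorphism subvs_of K -> 'M[C]_6} :=
  diag_morph (fun i => emb i (eps i) \o vsval).

Lemma weil_rmE x : weil_rm x = (conj_diag sigma x)^RC.
Proof.
by apply/matrixP => i j; rewrite !mxE /=; case: eqP => _; rewrite ?mulr0n ?mulr1n ?rmorph0.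
Qed.

Lemma weil_rm_integral x : integralOver intr x -> is_End weil_lattice (weil_rm x).
Proof.
move=> intx.
have [z zP] := fin_all_exists (fun j => eZ (integral_mul intx (inte j))).
pose Z : 'M[int]_6 := \matrix_(k, j) z j k.
have DB : conj_diag sigma x *m B = B *m map_mx intr Z.
  rewrite conj_diagM (@conjugates_comb _ _ _ sigma (map_mx intr Z) e); last first.
    by move=> j; rewrite zP; apply: eq_bigr => k _; rewrite !mxE scaler_int.
  by congr (_ *m _); apply/matrixP => i j; rewrite !mxE ratr_int.
have DBT : conj_diag sigma x *m (invmx B)^T = (invmx B)^T *m (map_mx intr Z)^T.
  rewrite -[conj_diag sigma x](tr_diag_mx) -!trmx_mul; congr _^T.
  by apply: (can_inj (mulmxK eu)); rewrite mulmxKV // -mulmxA DB mulKmx.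
move=> _ [m ->]; exists (@block_mx _ 6 6 6 6 Z 0 0 Z^T *m m).
rewrite map_mxM !mulmxA; congr (_ *m _).
rewrite (@map_block_mx _ _ _ 6 6 6 6) /period_mx (@mul_row_block _ 6 6 6 6 6).
rewrite !map_mx0 !mulmx0 addr0 add0r (@mul_mx_row _ 6 6 6 6).
have rmC : weil_rm x *m diag_mx (\row_i tau i) = diag_mx (\row_i tau i) *m weil_rm x.
  exact: diag_mxC.
apply: (congr2 (@row_mx _ 6 6 6)).
  by rewrite mulmxA rmC -!mulmxA weil_rmE int_mx -!map_mxM DB.
by rewrite weil_rmE int_mx -!map_mxM DBT map_trmx.
Qed.

Lemma weil_rm_symmetric x : is_rosati weil_form (weil_rm x) (weil_rm x).
Proof.
move=> v w; apply: eq_bigr => i _.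
rewrite !weil_rmE !map_diag_mx !mul_diag_mx !mxE /=.
rewrite ![RtoC _ * _]mulrC !ReMr !ImMr; ring.
Qed.

Definition weil_variety : ppavRM R L :=
  PPAVRM ((is_latticeP _).2 (ex_intro _ _ weil_lattice_basis)) weil_form_principal
    weil_rm_integral weil_rm_symmetric.

Lemma weil_variety_df : diagonal_form weil_variety weil_eta 1%:M eps.
Proof.
by split=> [|x|k]; rewrite ?unitmx1 // mulmx1 mul1mx.
Qed.

(** The Gram matrix [G] of the pairing [tr (rho x y)] is rational; it expresses a
basis of [rho O_L] in the dual basis, and [eta s] maps [rho O_L] to [tau O_L]. *)
Lemma weil_eta_s_rational : exists X, rational_rep period_mx (weil_eta s) X.
Proof.
pose rhoe j := rho * e j.
have [G GE] := gram_rat sigma_c_inj cP e rhoe.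
have rhoeE : conjugates sigma rhoe = conj_diag sigma rho *m B by rewrite conj_diagM.
have rho_neq0 i : sigma i rho != 0.
  by have := rhoP i; apply: contraTneq => ->; rewrite mulr0 ltxx.
have rhou : conj_diag sigma rho \in unitmx.
  rewrite unitmxE det_diag unitfE; apply/prodf_neq0 => i _; by rewrite mxE.
have Gu : G \in unitmx.
  by rewrite -(map_unitmx (ratr : {rmorphism rat -> R})) -GE rhoeE !unitmx_mul unitmx_tr eu rhou.
exists (@block_mx _ 6 6 6 6 0 (invmx G) (- d%:R *: G) 0).
have etaE : weil_eta s = diag_mx (\row_i signed_root (eps i)).
  by congr diag_mx; apply/rowP => i; rewrite !mxE /= embs.
have eta_tau : weil_eta s *m diag_mx (\row_i tau i) = (- d%:R *: conj_diag sigma rho)^RC.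
  rewrite etaE mulmx_diag; apply/matrixP => i j; rewrite !mxE.
  have -> : signed_root (eps i) * tau i = RtoC (- d%:R * sigma i rho).
    rewrite /tau mulrA rmorphM rmorphN rmorph_nat -sqr_isqrt expr2; congr (_ * _).
    by rewrite /signed_root; case: (eps i); rewrite ?mulrNN.
  by case: eqP => _; rewrite ?mulr0n ?mulr1n ?mulr0 ?rmorph0.
have eta_rho : weil_eta s *m (conj_diag sigma rho)^RC = diag_mx (\row_i tau i).
  rewrite etaE map_diag_mx mulmx_diag; congr diag_mx.
  by apply/rowP => i; rewrite !mxE.
have GB : B^T *m (conj_diag sigma rho *m B) = G^Q by rewrite -rhoeE GE.
rewrite /rational_rep ratr_mx (@map_block_mx _ _ _ 6 6 6 6) (@map_block_mx _ _ _ 6 6 6 6).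
rewrite /period_mx (@mul_row_block _ 6 6 6 6 6) (@mul_mx_row _ 6 6 6 6).
rewrite !map_mx0 !mulmx0 addr0 add0r; apply: (congr2 (@row_mx _ 6 6 6)).
  rewrite mulmxA eta_tau -!map_mxM; congr (_^RC).
  rewrite map_mxZ rmorphN rmorph_nat -scalemxAr -scalemxAl; congr (_ *: _).
  by rewrite -GB trmx_inv mulKmx // unitmx_tr.
rewrite -eta_rho -!mulmxA -!map_mxM; congr (_ *m _^RC).
have GQu : G^Q \in unitmx by rewrite map_unitmx.
apply: (can_inj (mulmxK GQu)); rewrite map_invmx mulmxA mulmxKV //.
by rewrite -GB trmx_inv mulKmx // unitmx_tr.
Qed.

Lemma weil_variety_weil : #|[set i | eps i]%SET| = 3%N ->
  weil_structure d s weil_variety weil_eta.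
Proof.
move=> eps3.
have rank_root b : \rank (eigenspace (weil_eta s) (signed_root b)) =
    #|[set i | eps i == b]%SET|.
  have etaE : 1%:M *m weil_eta s = diag_mx (emb_row eps s) *m 1%:M.
    exact: (df_eta weil_variety_df).
  rewrite (rank_eigenspace_diag _ (unitmx1 _ _) etaE).
  by apply: eq_card => i; rewrite !inE mxE embs (inj_eq signed_root_inj).
split.
- move=> k; have [X etaX] := weil_eta_s_rational; have [p ->] := sP k.
  apply: (rep_End0 weil_lattice_basis (A := horner_mx X p)).
  rewrite /rational_rep evalq_mx map_horner_mx; exact: horner_mx_intertwine.
- by move=> a k _ h _ v; rewrite !mulmxA; congr (h (_ *m v)); exact: diag_mxC.
- move=> v w; apply: eq_bigr => i _.
  rewrite mulNmx !mul_diag_mx !mxE /= embs /signed_root.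
  case: (v i 0) (w i 0) => [a b] [a' b'].
  by case: (eps i) => /=; ring.
- apply: etrans (rank_root true) _; apply: etrans eps3.
  by apply: eq_card => i; rewrite !inE eqb_id.
- apply: etrans (rank_root false) _.
  have -> : [set i | eps i == false]%SET = ~: [set i | eps i]%SET.
    by apply/setP => i; rewrite !inE eqbF_neg.
  by rewrite cardsCs finset.setCK eps3 card_ord.
Qed.

End Construction.

Lemma exists_weil_structure (S : {set 'I_6}) : #|S| = 3%N ->
  exists A eta, weil_structure d s A eta /\ has_signs d s sigma (S, ~: S) A eta.
Proof.
move=> S3; have [e [inte eu eZ]] := integral_basis sigma_c_inj cP intc.
(* [(-1) ^+ b] is positive for [b = false], whereas [eps i] is true for a plus. *)
have [rho rhoP] := prescribed_signs sigma_c_inj (fun i => ~~ (i \in S)).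
pose eps i := i \in S.
exists (weil_variety eu eZ inte (eps := eps) rhoP), (weil_eta eps); split.
  by apply: weil_variety_weil; rewrite -[RHS]S3; apply: eq_card => i; rewrite inE.
apply/(has_signs_df (weil_variety_df _ _ _ _)); first exact: sign_assignmentP.
by apply/setP => i; rewrite inE.
Qed.

(** * Counting CM types and comparing them with the components *)

Lemma card_all_CM_types :
  ([set Phi | @CM_type R M Phi] #= `I_64)%card /\
  ([set [set Phi; conj_type Phi] | Phi in @CM_type R M] #= `I_32)%card.
Proof.
apply: (@card_CM_types predT _ 32) => //; last first.
  rewrite (_ : [set S | _]%SET = powerset [set: 'I_6]%SET); last first.
    by apply/setP => S; rewrite !inE finset.subsetT.
  by rewrite card_powerset cardsT card_ord.
by apply/seteqP; split=> Phi => [/CM_typeP[S ->]|[S _ <-]]; [exists S|apply/CM_typeP; exists S].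
Qed.

Lemma card_weil_compatible :
  ([set Phi | weil_compatible d s sigma Phi] #= `I_20)%card /\
  ([set [set Phi; conj_type Phi] | Phi in weil_compatible d s sigma] #= `I_10)%card.
Proof.
apply: (@card_CM_types (fun S => #|S| == 3%N) _ 10) => [S||].
- by rewrite -(eqn_add2l #|S|) cardsC card_ord -[RHS](eqn_add2r 3) eq_sym.
- by apply/seteqP; split=> Phi => [/weil_compatibleP[S /eqP S3 ->]|[S /eqP S3 <-]];
    [exists S|apply/weil_compatibleP; exists S].
- by rewrite card_draws card_ord.
Qed.

Lemma signs_CM_type_bij : set_bij sign_assignment (weil_compatible d s sigma)
  (CM_type_of_signs d s sigma).
Proof.
split=> [I sI|I J|Phi /weil_compatibleP[S S3 ->]].
- by rewrite CM_type_of_signsE //; apply/weil_compatible_set; case: sI.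
- by rewrite !inE; exact: CM_type_of_signs_inj.
- by exists (S, ~: S); rewrite ?CM_type_of_signsE //; exact: sign_assignmentP.
Qed.

Lemma card_sign_assignment : (sign_assignment #= `I_20)%card.
Proof.
have [homo inj surj] := signs_CM_type_bij.
rewrite -(card_eql (inj_card_eq inj)) (_ : _ @` _ = weil_compatible d s sigma).
  exact: card_weil_compatible.1.
by apply/seteqP; split=> [_ [I sI <-]|Phi /surj //]; exact: homo.
Qed.

Lemma is_iso_refl (A : ppavRM R L) : is_iso A A 1%:M.
Proof.
by split=> [|v|v w|x]; rewrite ?unitmx1 ?mul1mx ?mulmx1.
Qed.

Lemma iso_class_CM_type (p q : ppavRMK R K L) :
  iso_class p = iso_class q -> CM_type_of p = CM_type_of q.
Proof.
move=> pq; have : iso_class q q.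
  by exists 1%:M => [|k]; [exact: is_iso_refl|rewrite mul1mx mulmx1].
by rewrite -pq => -[g]; exact: CM_type_of_iso.
Qed.

Local Notation component := (oriented_component d s sigma).

Lemma oriented_componentP I : sign_assignment I -> component I =
  [set iso_class p | p in [set p : ppavRMK R K L |
    weil_structure d s p.1 p.2 /\ CM_type_of p = CM_type_of_signs d s sigma I]].
Proof.
move=> sI; apply/seteqP; split=> _ [[A eta] [wA sgn] <-]; exists (A, eta) => //;
  by split=> //; apply/(has_signs_CM_type wA sI).
Qed.

Lemma oriented_component_mem I (p : ppavRMK R K L) : sign_assignment I ->
  weil_structure d s p.1 p.2 ->
  component I (iso_class p) <-> CM_type_of p = CM_type_of_signs d s sigma I.
Proof.
move=> sI wp; rewrite oriented_componentP //; split=> [[q [_ <-]]|pI]; last by exists p.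
by move/iso_class_CM_type.
Qed.

Lemma oriented_component_neq0 I : sign_assignment I -> component I !=set0.
Proof.
move=> [I2 I3 _]; have [A [eta wsA]] := exists_weil_structure I3.
by exists (iso_class (A, eta)), (A, eta) => //; case: I I2 I3 wsA => ? ? /= ->.
Qed.

Lemma oriented_component_trivIset : trivIset sign_assignment component.
Proof.
move=> I J sI sJ [P []]; rewrite oriented_componentP // => -[p [wp pI] <-].
by move/(oriented_component_mem sJ wp); rewrite pI; exact: CM_type_of_signs_inj.
Qed.

Lemma oriented_component_cover :
  \bigcup_(I in sign_assignment) component I = oriented_weil_locus d s.
Proof.
apply/seteqP; split=> [_ [I _ [p [wp _] <-]]|_ [[A eta] wA <-]]; first by exists p.
by have [I sI [sgn _]] := weil_signs wA; exists I => //; exists (A, eta).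
Qed.

Lemma oriented_component_bij :
  set_bij sign_assignment (component @` sign_assignment) component.
Proof.
apply: inj_bij => I J; rewrite !inE => sI sJ IJ.
apply: oriented_component_trivIset => //.
by rewrite -IJ setIid; exact: oriented_component_neq0.
Qed.

Lemma CM_type_component_bij :
  exists F : set {rmorphism M -> R[i]} -> set (set (ppavRMK R K L)),
  [/\ set_bij (weil_compatible d s sigma) (component @` sign_assignment) F,
      forall I, sign_assignment I ->
        F (CM_type_of_signs d s sigma I) = component I
    & forall Phi, weil_compatible d s sigma Phi ->
        forall p : ppavRMK R K L, weil_structure d s p.1 p.2 ->
        (F Phi (iso_class p) <-> CM_type_of p = Phi)].
Proof.
pose F Phi := [set iso_class p | p in [set p : ppavRMK R K L |
  weil_structure d s p.1 p.2 /\ CM_type_of p = Phi]].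
have FI I : sign_assignment I -> F (CM_type_of_signs d s sigma I) = component I.
  by move=> sI; rewrite oriented_componentP.
exists F; split=> // [|Phi _ p wp]; last first.
  by split=> [[q [_ <-]] /iso_class_CM_type //|pPhi]; exists p.
have [_ _ surj] := signs_CM_type_bij; have [_ inj _] := oriented_component_bij.
split=> [Phi /surj[I sI <-]|Phi Psi|_ [I sI <-]].
- by rewrite FI //; exists I.
- rewrite !inE => /surj[I sI <-] /surj[J sJ <-]; rewrite !FI // => IJ.
  by congr CM_type_of_signs; apply: inj; rewrite ?inE.
- exists (CM_type_of_signs d s sigma I); last exact: FI.
  by have [homo _ _] := signs_CM_type_bij; exact: homo.
Qed.

Section ModuliSpace.

Variables (X : Type) (cls : ppavRM R L -> X).
Hypothesis clsP : coarse_moduli cls.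
Variable kappa : {rmorphism subvs_of K -> subvs_of K}.
Hypothesis kappa_s : kappa s = - s.

Local Notation wcomp := (weil_component d s sigma cls).

Lemma weil_component_cover :
  \bigcup_(I in sign_assignment) wcomp I = weil_locus d s cls.
Proof.
apply/seteqP; split=> [_ [I _ [A [eta [wA _]] <-]]|_ [A [eta wA] <-]].
  by exists A => //; exists eta.
by have [I sI [sgn _]] := weil_signs wA; exists I => //; exists A => //; exists eta.
Qed.

Lemma weil_component_image I : sign_assignment I ->
  wcomp I = cls @` [set A | exists eta, component I (iso_class (A, eta))].
Proof.
move=> sI; apply/seteqP; split=> [_ [A [eta [wA sgn]] <-]|_ [A [eta [[B eta'] [wB sgnB]]] BA <-]].
  by exists A => //; exists eta, (A, eta).
have -> : cls A = cls B.
  apply/esym/clsP.2; have : iso_class (A, eta) (A, eta).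
    by exists 1%:M => [|k]; [exact: is_iso_refl|rewrite mul1mx mulmx1].
  by rewrite -BA => -[g isog _]; exists g.
by exists B => //; exists eta'.
Qed.

(** Composing [eta] with the complex conjugation of [K] exchanges the two
eigenspaces of [eta s]. *)
Lemma weil_structure_conj (A : ppavRM R L) (eta : {rmorphism subvs_of K -> 'M[C]_6}) :
  weil_structure d s A eta ->
  weil_structure d s A (eta \o kappa : {rmorphism subvs_of K -> 'M[C]_6}).
Proof.
move=> wA; have etaN : eta (kappa s) = - eta s by rewrite kappa_s rmorphN.
have rankN z : \rank (eigenspace (- eta s) z) = \rank (eigenspace (eta s) (- z)).
  rewrite !mxrank_ker; congr (_ - _)%N.
  have -> : - eta s - z%:M = - (eta s - (- z)%:M) by rewrite opprB [(- z)%:M]raddfN addrC.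
  by rewrite eqmx_opp.
have [_ EZ Eskew _ _ _ _] := pol_principal A.
have EN v w : pol A (- v) w = - pol A v w.
  by have := EZ (-1) v w; rewrite rmorphN1 scaleN1r mulN1r.
split=> [k|a k|v w||] /=.
- exact: (weil_End0 wA).
- exact: (weil_commute wA).
- rewrite etaN opprK mulNmx EN (weil_rosati wA) mulNmx.
  by rewrite Eskew EN opprK -Eskew.
- by rewrite etaN rankN (weil_eigen_neg wA).
- by rewrite etaN rankN opprK (weil_eigen_pos wA).
Qed.

Lemma has_signs_conj (A : ppavRM R L) (eta : {rmorphism subvs_of K -> 'M[C]_6}) I :
  has_signs d s sigma I A eta ->
  has_signs d s sigma (I.2, I.1) A (eta \o kappa : {rmorphism subvs_of K -> 'M[C]_6}).
Proof.
move=> [pos neg]; split=> i w iI wH /=; rewrite kappa_s rmorphN mulmxN.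
  by rewrite (neg i) // scaleNr opprK.
by rewrite (pos i) // scaleNr.
Qed.

Lemma weil_component_swap_sub I : wcomp I `<=` wcomp (I.2, I.1).
Proof.
move=> _ [A [eta [wA sgn]] <-]; exists A => //; exists (eta \o kappa).
by split; [exact: weil_structure_conj|exact: has_signs_conj].
Qed.

(** By [weil_signs_unique] a point of two components carries two Weil structures
that have the same signs or opposite ones. *)
Lemma weil_component_eq I J : sign_assignment I -> sign_assignment J ->
  wcomp I = wcomp J <-> J = I \/ J = (I.2, I.1).
Proof.
move=> sI sJ; split=> [IJ|[-> //|->]]; last first.
  apply/seteqP; split; first exact: weil_component_swap_sub.
  by case: I sI => I1 I2 _; exact: weil_component_swap_sub.
have [I2 I3 _] := sI; have [A [eta [wA]]] := exists_weil_structure I3.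
rewrite -I2 -surjective_pairing => sgnA.
have : wcomp J (cls A) by rewrite -IJ; exists A => //; exists eta.
move=> [B [eta' [wB sgnB]] /esym/clsP.2[g isog]].
have [W [eps [df _]]] := weil_diagonal_form wA.
have [b [W' _ df']] := weil_signs_unique isog wA wB df.
have I1E := (has_signs_df df sI).1 sgnA; have J1E := (has_signs_df df' sJ).1 sgnB.
case: b df' J1E => _ J1E; [right|left]; apply: sign_assignment_ext => //.
- by case: (sI) => _ I1 I2'; split=> //=; rewrite I2 finset.setCK.
- by rewrite /= I2 I1E J1E; apply/setP => i; rewrite !inE.
- by rewrite I1E J1E; apply/setP => i; rewrite !inE.
Qed.

End ModuliSpace.
End WeilStructures.

(** * Roots of unity of order 42 *)

Section Trigonometry.

Variable R : realType.
Local Notation C := R[i].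
Local Notation RtoC := (real_complex R).

Definition expi (x : R) : C := (cos x +i* sin x)%C.
Definition theta : R := pi / 21%:R.

Lemma expi_mulrn x n : expi (x *+ n) = expi x ^+ n.
Proof.
elim: n => [|n IHn]; first by rewrite mulr0n expr0 /expi cos0 sin0.
rewrite mulrS exprS -IHn /expi; apply/eqP; rewrite eq_complex /=.
by rewrite cosD sinD (addrC (sin x * _)) !eqxx.
Qed.

Lemma expi_mul_conj x : expi x * (expi x)^*%C = 1.
Proof.
apply/eqP; rewrite eq_complex /=; apply/andP; split; apply/eqP.
  by rewrite -(cos2Dsin2 x); ring.
by ring.
Qed.

Lemma theta21 : theta *+ 21 = pi.
Proof. by rewrite /theta -[LHS]mulr_natr divfK // pnatr_eq0. Qed.

Lemma expi21 : expi theta ^+ 21 = -1.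
Proof.
rewrite -expi_mulrn theta21 /expi cospi sinpi.
by apply/eqP; rewrite eq_complex /= oppr0 !eqxx.
Qed.

Lemma expi42 : expi theta ^+ 42 = 1.
Proof. by rewrite (exprM _ 21 2) expi21 sqrrN expr1n. Qed.

Lemma sin_theta_gt0 n : (0 < n < 21)%N -> 0 < sin (theta *+ n).
Proof.
move=> /andP[n_gt0 n_lt]; have th_gt0 : 0 < theta by rewrite divr_gt0 ?pi_gt0 ?ltr0n.
apply: sin_gt0_pi; apply/andP; split; first by rewrite pmulrn_lgt0.
by rewrite -[ltRHS]theta21 ltr_pMn2l.
Qed.

Lemma expi_theta_neq1 n : (0 < n <= 21)%N -> expi theta ^+ n != 1.
Proof.
move=> /andP[n_gt0]; rewrite leq_eqVlt => /orP[/eqP ->|n_lt].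
  by rewrite expi21 eq_sym -subr_eq0 opprK -mulr2n pnatr_eq0.
rewrite -expi_mulrn eq_complex /= negb_and orbC gt_eqF //.
by rewrite sin_theta_gt0 // n_gt0.
Qed.

Lemma expi_prim : 42.-primitive_root (expi theta).
Proof.
have [m pm m42] := prim_order_exists (isT : (0 < 42)%N) expi42.
have : m \in divisors 42 by rewrite -dvdn_divisors.
have m_gt0 := prim_order_gt0 pm; have /eqP := prim_expr_order pm.
have [m_le|m_gt] := leqP m 21; first by rewrite (negPf (expi_theta_neq1 _)) ?m_gt0.
move=> _; rewrite (_ : divisors 42 = [:: 1; 2; 3; 6; 7; 14; 21; 42]%N) // !inE.
by case/or4P => [/eqP m1|/eqP m1|/eqP m1|/or4P[/eqP m1|/eqP m1|/eqP m1|/orP[/eqP m1|/eqP m1]]];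
  move: m_gt; rewrite m1 // -[in X in X.-primitive_root _]m1.
Qed.

Lemma sin_expi n : (n <= 42)%N ->
  (0 +i* (sin (theta *+ n) *+ 2))%C = expi theta ^+ n - expi theta ^+ (42 - n).
Proof.
move=> n_le; have -> : expi theta ^+ (42 - n) = (expi (theta *+ n))^*%C.
  have nz : expi theta ^+ n != 0.
    by rewrite -expi_mulrn; apply: contra_eq_neq (expi_mul_conj (theta *+ n)) => ->;
      rewrite mul0r eq_sym oner_eq0.
  apply: (mulfI nz); rewrite -exprD subnKC // expi42 -expi_mulrn.
  by rewrite expi_mul_conj.
rewrite -expi_mulrn; apply/eqP; rewrite eq_complex /= subrr opprK mulr2n !eqxx.
by [].
Qed.

End Trigonometry.

Lemma sqr_gauss3 (F : fieldType) (w : F) : w ^+ 3 = -1 -> w != -1 ->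
  (w - w ^+ 5) ^+ 2 = - 3%:R.
Proof.
move=> w3 wN; have w2 : w ^+ 2 = w - 1.
  have : (w + 1) * (w ^+ 2 - (w - 1)) = w ^+ 3 + 1 by ring.
  move/eqP; rewrite w3 addNr mulf_eq0 addr_eq0 (negPf wN) /= subr_eq0 => /eqP.
  by [].
have -> : w ^+ 5 = w ^+ 3 * w ^+ 2 by rewrite -exprD.
rewrite w3 w2; have -> : (w - -1 * (w - 1)) ^+ 2 = 4%:R * w ^+ 2 - 4%:R * w + 1 by ring.
by rewrite w2; ring.
Qed.

(** The quadratic Gauss sum modulo 7. *)
Lemma sqr_gauss7 (F : fieldType) (t : F) : t ^+ 7 = 1 -> t != 1 ->
  (t - t ^+ 6 + (t ^+ 2 - t ^+ 5) - (t ^+ 3 - t ^+ 4)) ^+ 2 = - 7%:R.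
Proof.
move=> t7 tN; pose phi := 1 + t + t ^+ 2 + t ^+ 3 + t ^+ 4 + t ^+ 5 + t ^+ 6.
have phi0 : phi = 0.
  have : (t - 1) * phi = t ^+ 7 - 1 by rewrite /phi; ring.
  by move/eqP; rewrite t7 subrr mulf_eq0 subr_eq0 (negPf tN) => /eqP.
apply/eqP; rewrite -subr_eq0 opprK; apply/eqP.
(* The cofactor is the quotient by [phi] of the square of the sum plus 7. *)
rewrite -[RHS](mul0r (7%:R - 7%:R * t + t ^+ 2 + t ^+ 3 - 3%:R * t ^+ 4 + t ^+ 5 + t ^+ 6)).
by rewrite -phi0 /phi; ring.
Qed.

(** * The degree of a cyclotomic field *)

Lemma evalqE (F : fieldExtType rat) (p : {poly rat}) (x : F) :
  evalq p x = (map_poly ratr p).[x].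
Proof. exact: (rmorph_evalq (idfun : {rmorphism F -> F})). Qed.

Lemma vsval_evalq (M : fieldExtType rat) (E : {subfield M}) p (x : subvs_of E) :
  vsval (evalq p x) = evalq p (vsval x).
Proof. by rewrite rmorph_evalq evalqE. Qed.

Lemma Fadjoin1_evalq (M : fieldExtType rat) (E : {subfield M}) (x : subvs_of E) :
  (E : {vspace M}) = <<1; vsval x>>%VS ->
  forall y : subvs_of E, exists2 p : {poly rat},
    (size p <= \dim E)%N & y = evalq p x.
Proof.
move=> Ex y; have yE : vsval y \in <<1; vsval x>>%VS by rewrite -Ex subvsP.
have /polyOver1P[p Dp] := Fadjoin_polyOver 1 (vsval x) (vsval y).
exists p; last first.
  by apply: val_inj; rewrite /= vsval_evalq /evalq -Dp Fadjoin_poly_eq.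
rewrite Ex dim_Fadjoin dimv1 muln1.
by rewrite -(size_map_poly (in_alg M)) -Dp size_Fadjoin_poly.
Qed.

(** The minimal polynomial of a complex root of unity of order [n] is the [n]-th
cyclotomic polynomial; its irreducibility transfers to any field containing a
primitive root. *)
Lemma Cyclotomic_irreducible n : (0 < n)%N ->
  irreducible_poly (map_poly intr 'Phi_n : {poly rat}).
Proof.
move=> n_gt0; set P := map_poly _ _.
have szP : size P = (totient n).+1 by rewrite size_rat_int_poly size_Cyclotomic.
have nzP : P != 0 by rewrite -size_poly_eq0 szP.
have [z prim_z] := C_prim_root_exists n_gt0.
have [p [Dp monp] dv_p] := minCpolyP z.
have pP : p = P.
  apply: (map_inj_poly (fmorph_inj (ratr : {rmorphism rat -> algC})) (rmorph0 _)).
  rewrite -Dp (minCpoly_cyclotomic prim_z) -(Cintr_Cyclotomic prim_z) -map_poly_comp.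
  by apply: eq_map_poly => m /=; rewrite ratr_int.
split=> [|q q_neq1 qP]; first by rewrite szP ltnS totient_gt0.
have /dvdpP[r rq] := qP.
have : root (map_poly ratr (r * q) : {poly algC}) z by rewrite -rq dv_p pP.
rewrite rmorphM rootM !dv_p pP => /orP[Pr|Pq]; last by rewrite /eqp qP.
have /andP[nzr nzq] : (r != 0) && (q != 0) by move: nzP; rewrite rq mulf_eq0 negb_or.
have := dvdp_leq nzr Pr; rewrite rq size_mul //.
case: (size q) (size_poly_gt0 q) q_neq1 => [|[|m]]; rewrite ?nzq // => _ _.
by rewrite addnS addnS /= ltnNge leq_addr.
Qed.

(** A root of [X^n - 1] is a root of some ['Phi_d] with [d] dividing [n], and then
its order divides [d]. *)
Lemma root_Cyclotomic (F : fieldExtType rat) n (z : F) :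
  n.-primitive_root z -> evalq (map_poly intr 'Phi_n) z = 0.
Proof.
move=> prim_z; have n_gt0 := prim_order_gt0 prim_z.
have evP p : evalq (map_poly intr p) z = (map_poly intr p).[z].
  rewrite /evalq -map_poly_comp; congr (_.[_]); apply: eq_map_poly => m /=.
  exact: (rmorph_int (in_alg F)).
have prod0 (s : seq nat) : \prod_(d <- s) (map_poly intr 'Phi_d : {poly F}).[z] = 0 ->
    exists2 d, d \in s & (map_poly intr 'Phi_d : {poly F}).[z] = 0.
  elim: s => [|d s IHs]; first by rewrite big_nil => /eqP; rewrite oner_eq0.
  rewrite big_cons => /eqP; rewrite mulf_eq0 => /orP[/eqP d0|/eqP/IHs[d' d's d0]].
    by exists d; rewrite ?mem_head.
  by exists d'; rewrite // inE d's orbT.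
have root_pow m : (0 < m)%N ->
    \prod_(d <- divisors m) (map_poly intr 'Phi_d : {poly F}).[z] = z ^+ m - 1.
  move=> m_gt0; rewrite -horner_prod -rmorph_prod prod_Cyclotomic //.
  by rewrite rmorphB rmorph1 /= map_polyXn hornerD hornerN hornerXn hornerC.
have [d dn d0] : exists2 d, d \in divisors n & (map_poly intr 'Phi_d : {poly F}).[z] = 0.
  by apply: prod0; rewrite root_pow // prim_expr_order // subrr.
rewrite -dvdn_divisors // in dn.
have d_gt0 : (0 < d)%N := dvdn_gt0 n_gt0 dn.
have : z ^+ d - 1 = 0.
  rewrite -root_pow // (big_rem d) /= -?dvdn_divisors // d0 mul0r //.
move/eqP; rewrite subr_eq0 -(prim_order_dvd prim_z) => nd.
have -> : n = d by apply/eqP; rewrite eqn_dvd nd dn.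
by rewrite evP.
Qed.

Lemma dim_prim_root (M : fieldExtType rat) n (z : M) :
  n.-primitive_root z -> \dim <<1; z>> = totient n.
Proof.
move=> prim_z; have n_gt0 := prim_order_gt0 prim_z.
rewrite dim_Fadjoin dimv1 muln1; apply: succn_inj; rewrite -size_minPoly.
have [Pirr_size Pirr] := Cyclotomic_irreducible n_gt0.
pose P : {poly rat} := map_poly intr 'Phi_n; rewrite -/P in Pirr_size Pirr.
have szP : size P = (totient n).+1 by rewrite size_rat_int_poly size_Cyclotomic.
have /polyOver1P[p Dp] := minPolyOver 1 z.
have Pz : root (map_poly (in_alg M) P) z by apply/rootP; exact: root_Cyclotomic.
have pP : p %| P.
  rewrite -(dvdp_map (in_alg M)) -Dp minPoly_dvdp //.
  by apply/polyOver1P; exists P.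
have szp : size p = size (minPoly 1 z) by rewrite Dp size_map_poly.
have : p %= P by apply: Pirr => //; rewrite szp size_minPoly eqSS -lt0n.
by move/eqp_size; rewrite szp szP.
Qed.

(** * The field generated by a root of unity of order 42 *)

Lemma rmorph_lift (A B D : nzRingType) (j : {rmorphism B -> D}) (f : {rmorphism A -> D})
    (h : A -> B) : injective j -> (forall x, j (h x) = f x) ->
  exists h' : {rmorphism A -> B}, forall x, h' x = h x.
Proof.
move=> jinj jh.
have hB : zmod_morphism h by move=> x y; apply: jinj; rewrite rmorphB !jh rmorphB.
have hM : monoid_morphism h.
  by split=> [|x y]; apply: jinj; rewrite ?rmorph1 ?rmorphM !jh ?rmorph1 ?rmorphM.
pose h1 : {additive A -> B} := HB.pack h (GRing.isZmodMorphism.Build _ _ h hB).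
pose h2 : {rmorphism A -> B} := HB.pack h h1 (GRing.isMonoidMorphism.Build _ _ h hM).
by exists h2.
Qed.

(** [(a, b, e)] stands for the class of [29^a * 13^b * 25^e] modulo 42: 29 and 13
have order 2, 25 has order 3, and together they generate the units. *)
Definition unit_exponent (t : 'Z_2 * 'Z_2 * 'Z_3) : nat :=
  ((29 ^ t.1.1 * 13 ^ t.1.2 %% 42) * (25 ^ t.2 %% 42) %% 42)%N.

Lemma unit_exponentM t t' :
  unit_exponent (t * t')%g = (unit_exponent t * unit_exponent t')%N %[mod 42].
Proof.
case: t => [[a b] e]; case: t' => [[a' b'] e'].
case: a => [[|[|//]] ?]; case: b => [[|[|//]] ?]; case: e => [[|[|[|//]]] ?];
case: a' => [[|[|//]] ?]; case: b' => [[|[|//]] ?]; case: e' => [[|[|[|//]]] ?];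
by vm_compute.
Qed.

Lemma unit_exponent_inj t t' :
  unit_exponent t = unit_exponent t' %[mod 42] -> t = t'.
Proof.
case: t => [[a b] e]; case: t' => [[a' b'] e'].
case: a => [[|[|//]] ?]; case: b => [[|[|//]] ?]; case: e => [[|[|[|//]]] ?];
case: a' => [[|[|//]] ?]; case: b' => [[|[|//]] ?]; case: e' => [[|[|[|//]]] ?];
vm_compute => //= _; congr (_, _, _); exact: val_inj.
Qed.

Lemma unit_exponent_surj k : (k < 42)%N -> coprime k 42 -> exists t, unit_exponent t = k.
Proof.
move=> ltk cok; pose ts : seq ('Z_2 * 'Z_2 * 'Z_3) :=
  [seq (ab, e) | ab <- [seq (a, b) | a <- [:: 0; 1], b <- [:: 0; 1]], e <- [:: 0; 1; 2%:R]].
have /allP : all (fun k => coprime k 42 ==> (k \in map unit_exponent ts)) (seq.iota 0 42).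
  by vm_compute.
move=> /(_ k); rewrite mem_iota add0n ltk cok => /(_ isT) /mapP[t _ ->].
by exists t.
Qed.

Section CyclotomicField.

Variables (R : realType) (d : nat) (M : splittingFieldType rat).
Variables (iota : {rmorphism M -> R[i]}) (K L : {subfield M}).
Variables (s : subvs_of K) (c : subvs_of L).
Hypothesis hd : d = 3%N \/ d = 7%N.
Hypothesis hs : iota (vsval s) = isqrt R d.
Hypothesis hK : (K : {vspace M}) = <<1; vsval s>>%VS.
Hypothesis hc : iota (vsval c) = ((cos (pi / 21%:R))%:C)%C.
Hypothesis hL : (L : {vspace M}) = <<1; vsval c>>%VS.
Hypothesis hM : (K * L)%VS = fullv.

Local Notation C := R[i].
Local Notation RtoC := (real_complex R).
Local Notation theta := (theta R).
(* [iL] makes the compatibility of [iota] with the operations of [L] available to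
rewriting. *)
Let iL : {rmorphism subvs_of L -> C} := iota \o vsval.
Let iLE x : iota (vsval x) = iL x. Proof. by []. Qed.

Lemma discr_gt0 : (0 < d)%N. Proof. by case: hd => ->. Qed.

Lemma sqr_s : s ^+ 2 = - d%:R.
Proof.
apply: (fmorph_inj (iota \o vsval)); rewrite rmorphXn rmorphN rmorph_nat /= hs.
exact: sqr_isqrt.
Qed.

(** The Chebyshev recurrence
[sin ((n + 2) t) = 2 cos t sin ((n + 1) t) - sin (n t)]. *)
Lemma sin_ratio n : exists x : subvs_of L,
  iota (vsval x) * RtoC (sin theta) = RtoC (sin (theta *+ n)).
Proof.
suff [[x xP] _] : (exists x : subvs_of L, iota (vsval x) * RtoC (sin theta) =
      RtoC (sin (theta *+ n))) /\ (exists x : subvs_of L,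
      iota (vsval x) * RtoC (sin theta) = RtoC (sin (theta *+ n.+1))) by exists x.
elim: n => [|n [[x xP] [y yP]]].
  split; first by exists 0; rewrite iLE rmorph0 mul0r mulr0n sin0.
  by exists 1; rewrite iLE rmorph1 mul1r.
split; first by exists y.
exists (2%:R * c * y - x); rewrite iLE !rmorphB !rmorphM rmorph_nat -!iLE hc mulrBl.
rewrite -mulrA yP xP -(rmorph_nat RtoC) -!rmorphM -rmorphB; congr RtoC.
rewrite -[pi / _]/theta [theta *+ n.+2]mulrSr sinD.
have -> : theta *+ n = theta *+ n.+1 - theta by rewrite mulrSr addrK.
by rewrite sinB; ring.
Qed.

(** The Gauss sum for [sqrt (- d)] is odd in the root of unity, hence a combination
of the [2 i sin (n theta)], which are multiples of [2 i sin theta] by elements of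
[L]. *)
Lemma sqr_gauss_sin : exists x : subvs_of L,
  (iota (vsval x) * (0 +i* (sin theta *+ 2))%C) ^+ 2 = - d%:R.
Proof.
have sinE (y : C) n : y * RtoC (sin theta) = RtoC (sin (theta *+ n)) -> (n <= 42)%N ->
    y * (0 +i* (sin theta *+ 2))%C = expi theta ^+ n - expi theta ^+ (42 - n).
  move=> yn n42; rewrite -sin_expi //.
  have iE (r : R) : (0 +i* (r *+ 2))%C = RtoC r * (0 +i* 2)%C.
    by apply/eqP; rewrite eq_complex /= !(mulr0, mul0r, subr0, addr0) mulr_natr !eqxx.
  by rewrite iE mulrA yn -iE.
case: hd => ->.
  have [x xP] := sin_ratio 7; exists x; rewrite (sinE _ _ xP) //.
  rewrite (_ : (42 - 7 = 7 * 5)%N) // (exprM _ 7 5).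
  set w := expi theta ^+ 7.
  have w3 : w ^+ 3 = -1 by rewrite /w -(exprM _ 7 3); exact: (expi21 R).
  apply: sqr_gauss3 => //.
  apply: contra_neq (expi_theta_neq1 R (isT : (0 < 14 <= 21)%N)) => z7.
  by rewrite (exprM _ 7 2) -/w z7 sqrrN expr1n.
(* The squares modulo 7 are 1, 2 and 4; the exponents are 6 times 1, 2 and 3, and
4 = - 3 explains the last sign. *)
have [x1 x1P] := sin_ratio 6; have [x2 x2P] := sin_ratio 12; have [x3 x3P] := sin_ratio 18.
exists (x1 + x2 - x3); rewrite iLE rmorphB rmorphD -!iLE mulrBl mulrDl.
rewrite (sinE _ _ x1P) // (sinE _ _ x2P) // (sinE _ _ x3P) //.
rewrite (_ : (42 - 6 = 6 * 6)%N) // (_ : (42 - 12 = 6 * 5)%N) // (_ : (42 - 18 = 6 * 4)%N) //.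
rewrite (exprM _ 6 6) (exprM _ 6 5) (exprM _ 6 4) (exprM _ 6 2) (exprM _ 6 3).
set t := expi theta ^+ 6.
have t7 : t ^+ 7 = 1 by rewrite /t -(exprM _ 6 7); exact: (expi42 R).
apply: sqr_gauss7 => //.
exact: (expi_theta_neq1 R (isT : (0 < 6 <= 21)%N)).
Qed.

Lemma i_sin_theta : exists2 y : subvs_of L, y != 0 &
  iota (vsval s * vsval y) = (0 +i* sin theta)%C.
Proof.
have [x xP] := sqr_gauss_sin.
have d0 : - d%:R != 0 :> C by rewrite oppr_eq0 pnatr_eq0 -lt0n discr_gt0.
have nzx : x != 0.
  by apply: contra_eq_neq xP => ->; rewrite iLE rmorph0 mul0r expr0n /= eq_sym.
have sinE : (0 +i* (sin theta *+ 2))%C = (0 +i* sin theta)%C * 2%:R.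
  rewrite [RHS]mulr_natr [RHS]mulr2n; apply/eqP.
  by rewrite eq_complex /= addr0 mulr2n !eqxx.
have : (iota (vsval x) * (0 +i* (sin theta *+ 2))%C) ^+ 2 = iota (vsval s) ^+ 2.
  by rewrite xP hs sqr_isqrt.
pose w := x * 2%:R; have nzw : w != 0 by rewrite mulf_neq0 // -(fmorph_eq0 iL) rmorph_nat pnatr_eq0.
have nziw : iL w != 0 by rewrite fmorph_eq0.
have -> : iota (vsval x) * (0 +i* (sin theta *+ 2))%C = (0 +i* sin theta)%C * iL w.
  by rewrite /w rmorphM rmorph_nat sinE -iLE mulrCA.
move/eqP; rewrite eqf_sqr => /orP[] /eqP xs.
  exists w^-1; first by rewrite invr_eq0.
  by rewrite rmorphM iLE fmorphV -xs mulfK.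
exists (- w^-1); first by rewrite oppr_eq0 invr_eq0.
by rewrite rmorphM iLE rmorphN fmorphV mulrN -mulNr -xs mulfK.
Qed.

Lemma conj_unity_root (w : C) n : w ^+ n.+1 = 1 -> w ^+ n = w^*%C.
Proof.
move=> wn; have nzw : w != 0 by apply: contra_eq_neq wn => ->; rewrite expr0n eq_sym oner_eq0.
have /eqP : `|w| ^+ n.+1 = 1 by rewrite -normrX wn normr1.
rewrite pexpr_eq1 // => /eqP w1; apply: (mulfI nzw).
by rewrite -exprS wn -sqr_normc w1 expr1n.
Qed.

Lemma c_double (z : M) : iota z = expi theta -> z ^+ 42 = 1 ->
  vsval c = 2^-1 *: (z + z ^+ 41).
Proof.
move=> zE z42; apply: (scalerI (_ : 2 != 0 :> rat)) => //.
rewrite scalerA mulfV // scale1r.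
apply: (fmorph_inj iota); rewrite scaler_nat rmorphMn rmorphD rmorphXn zE hc.
rewrite conj_unity_root; last by rewrite -zE -rmorphXn z42 rmorph1.
rewrite mulr2n; apply/eqP; rewrite eq_complex /=.
by rewrite subrr addr0 !eqxx.
Qed.

(** As [iota (vsval s * vsval y)] is the imaginary part of a root of unity of order
42, that root lies in [M]. *)
Lemma exists_root42 : exists z : M, [/\ iota z = expi theta, 42.-primitive_root z,
  <<1; z>>%VS = fullv & exists y : subvs_of L, vsval s * vsval y = z - vsval c].
Proof.
have [y nzy yE] := i_sin_theta; exists (vsval c + vsval s * vsval y).
set z := _ + _.
have zE : iota z = expi theta.
  rewrite rmorphD yE hc; apply/eqP; rewrite eq_complex /= addr0 add0r !eqxx.
  by [].
have prim_z : 42.-primitive_root z by rewrite -(fmorph_primitive_root iota) zE expi_prim.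
split=> //; last by exists y; rewrite /z addrC addKr.
have z42 : z ^+ 42 = 1 := prim_expr_order prim_z.
have zz : z \in <<1; z>>%VS := memv_adjoin _ _.
have cz : vsval c \in <<1; z>>%VS.
  rewrite (c_double zE z42).
  by rewrite rpredZ // rpredD // rpredX.
have Lz : (L <= <<1; z>>)%VS.
  by rewrite hL; apply/FadjoinP; rewrite sub1v cz.
have sz : vsval s \in <<1; z>>%VS.
  have nzvy : vsval y != 0 by rewrite (inj_eq val_inj _ 0).
  have -> : vsval s = (z - vsval c) / vsval y by rewrite /z addrC addKr mulfK.
  by rewrite rpred_div ?rpredB // (subvP Lz) ?subvsP.
have Kz : (K <= <<1; z>>)%VS.
  by rewrite hK; apply/FadjoinP; rewrite sub1v sz.
apply/eqP; rewrite eqEsubv subvf -hM.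
by apply: subv_trans (prodvS Kz Lz) _; rewrite prodv_id.
Qed.

Section WithRoot.

Variables (z : M) (y : subvs_of L).
Hypothesis zE : iota z = expi theta.
Hypothesis prim_z : 42.-primitive_root z.
Hypothesis zM : <<1; z>>%VS = fullv.
Hypothesis sy : vsval s * vsval y = z - vsval c.

Lemma dim_M : \dim {:M} = 12%N.
Proof. by rewrite -zM (dim_prim_root prim_z). Qed.

Lemma evalq_z (x : M) : exists p, x = evalq p z.
Proof.
have /Fadjoin1_polyP[p ->] : x \in <<1; z>>%VS by rewrite zM memvf.
by exists p.
Qed.

Lemma rmorph_ext_z (B : fieldType) (f g : {rmorphism M -> B}) : f z = g z -> f = g.
Proof.
move=> fg; apply: rmorph_ext => x; have [p ->] := evalq_z x.
by rewrite !rmorph_evalq fg.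
Qed.

Lemma rmorph_ext_LK (B : fieldType) (f g : {rmorphism M -> B}) :
  (forall x : subvs_of L, f (vsval x) = g (vsval x)) ->
  f (vsval s) = g (vsval s) -> f = g.
Proof.
move=> fgL fgs; apply: rmorph_ext_z.
by rewrite -[z](subrK (vsval c)) -sy !rmorphD !rmorphM fgs !fgL.
Qed.

(** Every embedding of [M] maps [z] to a complex number of modulus 1, so it maps
[c], the real part of [z], to a real number. *)
Lemma emb_c_real (f : {rmorphism M -> C}) : exists r, f (vsval c) = RtoC r.
Proof.
have fz : f z ^+ 42 = 1 by rewrite -rmorphXn (prim_expr_order prim_z) rmorph1.
exists (complex.Re (f z)); apply: (mulIf (_ : 2 != 0)); first by rewrite pnatr_eq0.
rewrite mulr_natr -rmorphMn (c_double zE (prim_expr_order prim_z)).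
rewrite -scaler_nat scalerA mulfV // scale1r rmorphD rmorphXn (conj_unity_root fz).
by rewrite addcJ mulrC.
Qed.

Lemma emb_L_real (f : {rmorphism M -> C}) (x : subvs_of L) :
  exists r, f (vsval x) = RtoC r.
Proof.
have [r fc] := emb_c_real f; have [p _ ->] := Fadjoin1_evalq hL x.
exists (map_poly ratr p).[r]; rewrite vsval_evalq rmorph_evalq fc -horner_map -map_poly_comp.
by congr (_.[_]); apply: eq_map_poly => q /=; rewrite fmorph_rat.
Qed.

Lemma s_notin_L : vsval s \notin L.
Proof.
apply/negP => sL; have [r] := emb_L_real iota (Subvs sL).
rewrite /= hs => /eqP; rewrite eq_complex /= => /andP[_].
by rewrite sqrtr_eq0 leNgt ltr0n discr_gt0.
Qed.

(** [L] is a proper subfield because [s] is not real. *)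
Lemma dim_L : (\dim L <= 6)%N.
Proof.
have := field_dimS (subvf L); rewrite dim_M.
have dim_lt : (\dim L < 12)%N.
  rewrite -dim_M ltn_neqAle dimvS ?subvf // andbT.
  apply: contra s_notin_L => dimL; suff -> : (L : {vspace M}) = fullv by exact: memvf.
  by apply/eqP; rewrite eqEdim subvf (eqP dimL) /=.
case/dvdnP => [[|[|q]] E]; first by rewrite mul0n in E.
  by rewrite E mul1n ltnn in dim_lt.
by rewrite -(leq_pmul2l (isT : (0 < 2)%N)) [leqRHS](E : (2 * 6)%N = _) leq_mul2r orbT.
Qed.

(** Unlike [c], its double [zeta + zeta^-1] is an algebraic integer. *)
Definition c2 : subvs_of L := c *+ 2.

Lemma L_adjoin_c2 : (L : {vspace M}) = <<1; vsval c2>>%VS.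
Proof.
apply: etrans hL _; apply/eqP; rewrite eqEsubv; apply/andP; split; apply/FadjoinP; rewrite sub1v.
  have -> : vsval c = 2^-1 *: vsval c2.
    by rewrite rmorphMn -scaler_nat scalerA mulVf // scale1r.
  by rewrite rpredZ // memv_adjoin.
by rewrite rmorphMn rpredMn // memv_adjoin.
Qed.

Lemma L_evalq_c2 (x : subvs_of L) : exists2 p : {poly rat}, (size p <= 6)%N & x = evalq p c2.
Proof.
have [p szp xE] := Fadjoin1_evalq L_adjoin_c2 x; exists p => //.
exact: leq_trans szp dim_L.
Qed.

Lemma integral_c2 : integralOver intr c2.
Proof.
suff : integralOver intr (vsval c2).
  by move/(integralOver_rmorph (vsval : {rmorphism subvs_of L -> M})).
have intz : integralOver intr z.
  exists ('X^42 - 1); first by rewrite monicXnsubC.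
  by rewrite rmorphB rmorph1 /= map_polyXn rootE !hornerE (prim_expr_order prim_z) subrr.
have -> : vsval c2 = z + z ^+ 41.
  have -> : vsval c2 = vsval c *+ 2 by exact: (rmorphMn vsval).
  rewrite (c_double zE (prim_expr_order prim_z)).
  by rewrite -scaler_nat scalerA mulfV // scale1r.
apply: integral_add => //; elim: 41%N => [|n IHn]; first exact: integral1.
by rewrite exprS; apply: integral_mul.
Qed.

Lemma K_evalq (k : subvs_of K) : exists p : {poly rat}, k = evalq p s.
Proof. by have [p _ ->] := Fadjoin1_evalq hK k; exists p. Qed.

Lemma galois_M : galois 1 {:M}.
Proof.
rewrite /galois sub1v normalFieldf andbT; apply/separableP => x _.
apply: pcharf0_separable; apply/pcharf0P => n.
by rewrite -(fmorph_eq0 iota) rmorph_nat pnatr_eq0.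
Qed.

Lemma card_gal : #|'Gal({:M} / 1)%g| = 12%N.
Proof. by rewrite -(galois_dim galois_M) dimv1 divn1 dim_M. Qed.

Lemma gal_ext_z (g h : gal_of {:M}) : g z = h z -> g = h.
Proof.
move=> gh; apply/eqP/gal_eqP => x _; have [p ->] := evalq_z x.
by rewrite !rmorph_evalq /= gh.
Qed.

Section Embeddings.

Variable sigma : 'I_6 -> {rmorphism subvs_of L -> R}.
Hypothesis hsigma : bijective sigma.

Lemma sigma_c2_inj : injective (fun i => sigma i c2).
Proof.
move=> i j ij; apply: (bij_inj hsigma); apply: rmorph_ext => x.
have [p _ ->] := L_evalq_c2 x; rewrite !rmorph_evalq.
by have /= -> := ij.
Qed.

(** The restriction of [f] to [L] is real, so it is one of the [sigma i]. *)
Lemma emb_signs (f : {rmorphism M -> C}) : exists ib : 'I_6 * bool,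
  (forall x : subvs_of L, f (vsval x) = RtoC (sigma ib.1 x)) /\
  f (vsval s) = signed_root R d ib.2.
Proof.
pose t (x : subvs_of L) := complex.Re (f (vsval x)).
have tE (x : subvs_of L) : RtoC (t x) = f (vsval x).
  by have [r fx] := emb_L_real f x; rewrite /t fx.
have [t' t'E] := rmorph_lift (j := RtoC) (f := f \o vsval) (@complexI R) tE.
have [sigma' _ sigmaK] := hsigma.
exists (sigma' t', f (vsval s) == isqrt R d); split=> [x|] /=.
  by rewrite sigmaK t'E tE.
apply: sqrt_signed; rewrite -!rmorphXn.
by have /= -> := congr1 (f \o vsval) sqr_s; rewrite !rmorphN !rmorph_nat.
Qed.

(** There are as many automorphisms of [M] as pairs of an embedding of [L] and a
sign, so each pair is the restriction of an embedding of [M]. *)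
Lemma exists_emb : exists emb : 'I_6 -> bool -> {rmorphism M -> C},
  [/\ forall i b (x : subvs_of L), emb i b (vsval x) = RtoC (sigma i x),
      forall i b, emb i b (vsval s) = signed_root R d b,
      forall f, exists i b, f = emb i b
    & exists g : gal_of {:M}, iota (g (vsval s)) = - iota (vsval s)].
Proof.
have [h hP] := fin_all_exists (fun g : gal_of {:M} => emb_signs (iota \o g)).
have hinj : injective h.
  move=> g g' gg'; apply: gal_ext_z; apply: (fmorph_inj iota).
  have := hP g; have := hP g'; rewrite gg' => -[g'L g's] [gL gs].
  suff : iota \o g = iota \o g' :> {rmorphism M -> C}.
    by move/(congr1 (fun f : {rmorphism M -> C} => f z)).
  apply: rmorph_ext_LK => [x|]; first exact: etrans (gL x) (esym (g'L x)).
  exact: etrans gs (esym g's).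
have [h' hK' h'K] : bijective h.
  apply: (inj_card_bij hinj); rewrite card_prod card_ord card_bool.
  by rewrite -[(6 * 2)%N]/12%N -card_gal; exact: max_card.
pose emb i b : {rmorphism M -> C} := iota \o h' (i, b).
have embL i b (x : subvs_of L) : emb i b (vsval x) = RtoC (sigma i x).
  by have [hL' _] := hP (h' (i, b)); apply: etrans (hL' x) _; rewrite h'K.
have embs i b : emb i b (vsval s) = signed_root R d b.
  by have [_ hs'] := hP (h' (i, b)); apply: etrans hs' _; rewrite h'K.
exists emb; split=> // [f|]; last first.
  by exists (h' (ord0, false)); rewrite hs; exact: (embs ord0 false).
have [[i b] [fL fs]] := emb_signs f; exists i, b.
by apply: rmorph_ext_LK => [x|]; rewrite ?fL ?embL ?fs ?embs.
Qed.

End Embeddings.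

Lemma exists_conj_K (g : gal_of {:M}) :
  iota (g (vsval s)) = - iota (vsval s) ->
  exists kappa : {rmorphism subvs_of K -> subvs_of K}, kappa s = - s.
Proof.
move=> gs; have gsN : g (vsval s) = - vsval s by apply: (fmorph_inj iota); rewrite gs rmorphN.
have gK (k : subvs_of K) : vsval (vsproj K (g (vsval k))) = g (vsval k).
  rewrite vsprojK //; have [p ->] := K_evalq k.
  have -> : g (vsval (evalq p s)) = vsval (evalq p (- s)).
    rewrite !vsval_evalq rmorph_evalq -[(g : {rmorphism M -> M}) _]/(g (vsval s)) gsN evalqE.
    by rewrite (_ : vsval (- s) = - vsval s) //; exact: (rmorphN vsval).
  exact: subvsP.
have [kappa kappaE] := rmorph_lift (j := vsval) (f := g \o vsval) (@val_inj _ _ _) gK.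
exists kappa; apply: val_inj; rewrite kappaE; apply: etrans (gK s) _.
by rewrite gsN; exact: esym (rmorphN vsval s).
Qed.

(** An automorphism is determined by the exponent [k], a unit modulo 42, such that
it maps [z] to [z ^+ k]. *)
Lemma gal_isog : 'Gal({:M} / 1) \isog [set: ('Z_2 * 'Z_2 * 'Z_3)%type]%SET.
Proof.
have z42 : z ^+ 42 = 1 := prim_expr_order prim_z.
have expP (g : gal_of {:M}) : exists t, g z = z ^+ unit_exponent t.
  have [k Dk] : exists k : 'I_42, g z = z ^+ k.
    have := prim_rootP prim_z (_ : g z ^+ 42 = 1).
    by rewrite -rmorphXn z42 rmorph1 => /(_ erefl)[k]; exists k.
  have [|t tk] := unit_exponent_surj (ltn_ord k); last by exists t; rewrite tk.
  by rewrite -(prim_root_exp_coprime _ prim_z) -Dk fmorph_primitive_root.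
have [e eP] := fin_all_exists expP.
have eM : {in 'Gal({:M} / 1)%g &, {morph e : g h / (g * h)%g >-> (g * h)%g}}.
  move=> g h _ _; apply: unit_exponent_inj; apply/eqP; rewrite unit_exponentM.
  rewrite -(eq_prim_root_expr prim_z) -eP galM ?memvf // eP rmorphXn /= eP -exprM mulnC.
  by [].
pose f := Morphism eM.
have injf : ('injm f)%g.
  by apply/injmP => g h _ _ /= efg; apply: gal_ext_z; rewrite !eP efg.
apply/isogP; exists f => //; apply/eqP; rewrite eqEcard finset.subsetT /=.
by rewrite card_injm // card_gal cardsT !card_prod !card_ord.
Qed.

End WithRoot.
End CyclotomicField.

(** * CM types and Weil loci for the field of roots of unity of order 42 *)

Theorem proposition11 (R : realType) (d : nat) (hd : d = 3%N \/ d = 7%N)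
    (M : splittingFieldType rat) (iota : {rmorphism M -> R[i]})
    (K L : {subfield M}) (s : subvs_of K) (c : subvs_of L)
    (hs : iota (vsval s) = isqrt R d)
    (hK : (K : {vspace M}) = <<1; vsval s>>%VS)
    (hc : iota (vsval c) = ((cos (pi / 21%:R))%:C)%C)
    (hL : (L : {vspace M}) = <<1; vsval c>>%VS)
    (hM : (K * L)%VS = fullv)
    (sigma : 'I_6 -> {rmorphism subvs_of L -> R}) (hsigma : bijective sigma)
    (hsigma1 : forall x, ((sigma ord0 x)%:C)%C = iota (vsval x)) :
  (exists z : M,
     iota z = (cos (2%:R * pi / 42%:R) +i* sin (2%:R * pi / 42%:R))%C /\
     <<1; z>>%VS = fullv :> {vspace M})
  /\
  (galois 1 {:M} /\
   'Gal({:M} / 1) \isog [set: ('Z_2 * 'Z_2 * 'Z_3)%type]%SET)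
  /\
  [/\ ([set Phi | @CM_type R M Phi] #= `I_64)%card,
      ([set [set Phi; conj_type Phi] | Phi in @CM_type R M] #= `I_32)%card
    & forall Phi, @CM_type R M Phi -> Phi <> conj_type Phi]
  /\
  [/\ ([set Phi | weil_compatible d s sigma Phi] #= `I_('C(6, 3)))%card,
      'C(6, 3) = 20%N
    & ([set [set Phi; conj_type Phi] | Phi in weil_compatible d s sigma]
         #= `I_10)%card]
  /\
  [/\ (sign_assignment #= `I_20)%card,
      set_bij sign_assignment (weil_compatible d s sigma)
        (CM_type_of_signs d s sigma),
      [/\ forall I, sign_assignment I ->
            oriented_component d s sigma I !=set0,
          trivIset sign_assignment (oriented_component d s sigma),
          \bigcup_(I in sign_assignment) oriented_component d s sigma I
            = oriented_weil_locus d s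
        & set_bij sign_assignment
            (oriented_component d s sigma @` sign_assignment)
            (oriented_component d s sigma)],
      (exists F : set {rmorphism M -> R[i]} -> set (set (ppavRMK R K L)),
         [/\ set_bij (weil_compatible d s sigma)
               (oriented_component d s sigma @` sign_assignment) F,
             forall I, sign_assignment I ->
               F (CM_type_of_signs d s sigma I)
                 = oriented_component d s sigma I
           & forall Phi, weil_compatible d s sigma Phi ->
               forall p : ppavRMK R K L, weil_structure d s p.1 p.2 ->
               (F Phi (iso_class p) <-> CM_type_of p = Phi)])
    & forall (X : Type) (cls : ppavRM R L -> X), coarse_moduli cls ->
      [/\ \bigcup_(I in sign_assignment) weil_component d s sigma cls I
            = weil_locus d s cls,
          forall I, sign_assignment I ->
            weil_component d s sigma cls I
              = cls @` [set A | exists eta,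
                  oriented_component d s sigma I (iso_class (A, eta))]
        & forall I J, sign_assignment I -> sign_assignment J ->
            (weil_component d s sigma cls I = weil_component d s sigma cls J
               <-> J = I \/ J = (I.2, I.1))]].
Proof.
have [z [zE prim_z zM [y sy]]] := exists_root42 hd hs hK hc hL hM.
have [emb [embL embs embP [g gs]]] := exists_emb hs hc hL zE prim_z zM sy hsigma.
have [kappa kappa_s] := exists_conj_K hK gs.
have cinj : injective (fun i => sigma i (c2 c)).
  exact: (sigma_c2_inj hd hs hc hL zE prim_z zM hsigma).
have cP := L_evalq_c2 hd hs hc hL zE prim_z zM.
have intc := integral_c2 hc zE prim_z.
have d_gt0 := discr_gt0 hd; have s2 := sqr_s hs; have KP := K_evalq hK.
have bin63 : 'C(6, 3) = 20%N by [].
split.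
  exists z; split=> //; rewrite zE /expi /theta.
  by have -> : 2%:R * pi / 42%:R = pi / 21%:R :> R by field.
split; first by split; [exact: galois_M iota | exact: (gal_isog iota prim_z zM)].
split.
  have [card64 card32] := card_all_CM_types cinj d_gt0 embL embs embP.
  split=> // Phi; exact: (CM_type_neq_conj cinj d_gt0 embL embs embP).
split.
  have [card20 card10] := card_weil_compatible cinj d_gt0 embL embs embP.
  by split=> //; rewrite bin63.
split.
- exact: (card_sign_assignment cinj d_gt0 embL embs embP).
- exact: (signs_CM_type_bij cinj d_gt0 embL embs embP).
- split.
  + move=> I; exact: (oriented_component_neq0 cinj cP intc d_gt0 KP embs).
  + exact: (oriented_component_trivIset cinj cP intc d_gt0 s2 KP embL embs embP).
  + exact: (oriented_component_cover cinj cP intc d_gt0 s2 KP embL embs embP).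
  + exact: (oriented_component_bij cinj cP intc d_gt0 s2 KP embL embs embP).
- exact: (CM_type_component_bij cinj cP intc d_gt0 s2 KP embL embs embP).
move=> X cls clsP; split=> [|I|I J].
- exact: (weil_component_cover cinj cP intc d_gt0 s2 KP embL embs embP).
- exact: (weil_component_image d s sigma clsP).
- exact: (weil_component_eq cinj cP intc d_gt0 s2 KP embs clsP kappa_s).
Qed.
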